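(* Let $K$ be a number field, $A$ its ring of integers and $I$ a nonzero ideal of $A$. Then $A/I$ is coverable if and only if $I$ is faulty.
   Context: Convention: a subring of a ring $R$ is an additive subgroup closed under multiplication, not necessarily containing $1$; proper means different from $R$; $R$ is coverable if it is the union of its proper subrings. For a prime $p$ and integer $f\ge1$, $N_p(f)$ is the number of monic irreducible polynomials of degree $f$ over $\mathbb{F}_p$, and $\tau_p(f)=p$ if $f=1$, $\tau_p(f)=N_p(f)+1$ if $f\ge2$. A nonzero ideal $I$ of $A$ is faulty if there exist a prime $p$ and an integer $f\ge1$ with $\tau_p(f)\le I_p(f)$, where $I_p(f)$ is the number of prime ideals of $A$ lying over $p\mathbb{Z}$, dividing $I$, and having residual degree $f$. *)

(* Defs.v *)
From HB Require Import structures.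
From mathcomp Require Import all_boot all_order all_algebra all_field.
From mathcomp Require Import ring_quotient.
From mathcomp Require Import finmap boolp classical_sets cardinality.

Set Implicit Arguments.
Unset Strict Implicit.
Unset Printing Implicit Defensive.

Import GRing.Theory.

Local Open Scope ring_scope.
Local Open Scope classical_set_scope.
Local Open Scope quotient_scope.

(* Subrings need not contain 1. *)
Definition is_subring (R : pzRingType) (S : set R) : Prop :=
  zmod_closed [in S] /\ GRing.mulr_2closed [in S].

Definition proper_subring (R : pzRingType) (S : set R) : Prop :=
  is_subring S /\ S <> setT.

Definition coverable (R : pzRingType) : Prop :=
  \bigcup_(S in [set S : set R | proper_subring S]) S = setT.

Definition is_ideal (R : comNzRingType) (I : set R) : Prop :=
  zmod_closed [in I] /\ forall a, {in I, forall u, a * u \in I}.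

(* Unlike [idealr] of ring_quotient, the whole ring is allowed here. *)
Record ideal (R : comNzRingType) := Ideal {
  ideal_set :> set R;
  _ : `[< is_ideal ideal_set >]
}.

HB.instance Definition _ (R : comNzRingType) := [isSub for @ideal_set R].
HB.instance Definition _ (R : comNzRingType) := [Choice of ideal R by <:].

Section Quotient.
Variables (R : comNzRingType) (I : ideal R).

Definition ideal_mem : {pred R} := [in ideal_set I].

Fact idealP : is_ideal I.
Proof. by case: I => J /= /asboolP. Qed.

Fact ideal_zmod_closed : zmod_closed ideal_mem.
Proof. exact: idealP.1. Qed.

HB.instance Definition _ := GRing.isZmodClosed.Build R ideal_mem ideal_zmod_closed.

Fact ideal_mull a u : u \in ideal_mem -> a * u \in ideal_mem.
Proof. exact: idealP.2. Qed.

(* The additive quotient R/I of the library, on which the multiplication is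
   built below without assuming I <> R: R/I is the zero ring when I = R. *)
Definition quotient : Type := Quotient.quot ideal_mem.

HB.instance Definition _ := Choice.on quotient.
HB.instance Definition _ := GRing.Zmodule.on quotient.
HB.instance Definition _ := EqQuotient.on quotient.

Definition quotient_one : quotient := \pi_quotient 1.
Definition quotient_mul (x y : quotient) : quotient :=
  \pi_quotient (repr x * repr y).

Fact quotient_eqP (x y : R) :
  (x - y \in ideal_mem) = (\pi_quotient x == \pi_quotient y).
Proof. exact: Quotient.idealrBE. Qed.

Fact quotient_mulE (x y : R) :
  quotient_mul (\pi x) (\pi y) = \pi_quotient (x * y).
Proof.
apply/eqP; rewrite -quotient_eqP.
set x' := repr _; set y' := repr _.
have xx : x' - x \in ideal_mem by rewrite quotient_eqP reprK.
have yy : y' - y \in ideal_mem by rewrite quotient_eqP reprK.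
have -> : x' * y' - x * y = y' * (x' - x) + x * (y' - y).
  by rewrite !mulrBr addrA (mulrC y' x') (mulrC y' x) addrNK.
by rewrite rpredD ?ideal_mull.
Qed.

Fact quotient_addE (x y : R) :
  \pi_quotient x + \pi_quotient y = \pi_quotient (x + y).
Proof. exact/esym/(pi_addr (s := Quotient.quot ideal_mem)). Qed.

Fact quotient_mulA : associative quotient_mul.
Proof.
move=> x y z; rewrite -[x]reprK -[y]reprK -[z]reprK.
set a := repr x; set b := repr y; set c := repr z.
rewrite (quotient_mulE b c) (quotient_mulE a (b * c)).
by rewrite (quotient_mulE a b) (quotient_mulE (a * b) c) mulrA.
Qed.
Fact quotient_mulC : commutative quotient_mul.
Proof.
by move=> x y; rewrite -[x]reprK -[y]reprK !quotient_mulE mulrC.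
Qed.
Fact quotient_mul1 : left_id quotient_one quotient_mul.
Proof. by move=> x; rewrite -[x]reprK quotient_mulE mul1r. Qed.
Fact quotient_mulD : left_distributive quotient_mul +%R.
Proof.
move=> x y z; rewrite -[x]reprK -[y]reprK -[z]reprK.
set a := repr x; set b := repr y; set c := repr z.
rewrite quotient_addE (quotient_mulE (a + b) c) (quotient_mulE a c).
by rewrite (quotient_mulE b c) quotient_addE mulrDl.
Qed.

HB.instance Definition _ := GRing.Zmodule_isComPzRing.Build quotient
  quotient_mulA quotient_mulC quotient_mul1 quotient_mulD.

End Quotient.

Definition ideal_mul (R : comNzRingType) (I J : ideal R) : set R :=
  [set x | exists (n : nat) (u v : 'I_n -> R),
     (forall i, u i \in ideal_set I /\ v i \in ideal_set J) /\
     x = \sum_(i < n) u i * v i].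

Definition ideal_divides (R : comNzRingType) (P I : ideal R) : Prop :=
  exists J : ideal R, ideal_set I = ideal_mul P J.

Definition prime_ideal (R : comNzRingType) (P : ideal R) : Prop :=
  1 \notin ideal_set P /\ prime_idealr_closed [in ideal_set P].

Definition lies_over (R : comNzRingType) (P : ideal R) (p : nat) : Prop :=
  forall n : int, (n%:~R \in ideal_set P) = (p %| n)%Z.

(* R/P has dimension f over 'F_p: it has a basis b of f elements. A scalar c
   acts on R/P as multiplication by its natural representative below p, which
   is the 'F_p-module structure when p is prime and P lies over p. *)
Definition has_residual_degree (R : comNzRingType) (P : ideal R) (p f : nat) :
    Prop :=
  exists b : 'I_f -> quotient P, forall x : quotient P,
    exists! c : {ffun 'I_f -> 'F_p}, x = \sum_(i < f) b i *+ (c i : nat).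

Definition num_irreducible (p f : nat) : nat :=
  #|[set q : {poly_(f.+1) 'F_p} | [&& size q == f.+1,
      (q : {poly 'F_p}) \is monic & irreducibleb (q : {poly 'F_p})]]%SET|.

Definition tau (p f : nat) : nat :=
  if f == 1%N then p else (num_irreducible p f).+1.

(* The cardinal of [fset_set S] is that of S when S is finite, which is the
   case here for a nonzero ideal I of a ring of integers. *)
Definition num_prime_divisors (R : comNzRingType) (I : ideal R) (p f : nat) :
    nat :=
  #|` fset_set [set P : ideal R | [/\ prime_ideal P, lies_over P p,
                    ideal_divides P I & has_residual_degree P p f]] |%fset.

Definition faulty (R : comNzRingType) (I : ideal R) : Prop :=
  exists p f : nat, [/\ prime p, (1 <= f)%N &
    (tau p f <= num_prime_divisors I p f)%N].

Section RingOfIntegers.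
Variable K : fieldExtType rat.

Definition integral_over_int : {pred K} :=
  fun x => `[< integralOver (intr : int -> K) x >].

Fact integral_over_int_subring_closed : subring_closed integral_over_int.
Proof.
split=> [|x y /asboolP x_int /asboolP y_int|x y /asboolP x_int /asboolP y_int];
  apply/asboolP; [exact: integral1 | exact: integral_sub | exact: integral_mul].
Qed.

HB.instance Definition _ :=
  GRing.isSubringClosed.Build K integral_over_int integral_over_int_subring_closed.

Record ring_of_integers : Type := RingOfIntegers {
  int_val :> K;
  _ : int_val \in integral_over_int
}.

HB.instance Definition _ := [isSub for int_val].
HB.instance Definition _ := [Choice of ring_of_integers by <:].
HB.instance Definition _ :=
  [SubChoice_isSubComNzRing of ring_of_integers by <:].

End RingOfIntegers.

(* Main.v *)
Require Import Defs.
From HB Require Import structures.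
From mathcomp Require Import fingroup.
From mathcomp Require Import all_boot all_order all_algebra all_field.
From mathcomp Require Import qpoly qfpoly ring.
From mathcomp Require Import finmap boolp classical_sets cardinality.

(** R/I fails to be coverable exactly when it is generated, as a ring without
    unit, by one element x.  Modulo the prime ideals P containing I, such an x
    has minimal polynomials over 'F_p which differ from 'X, and which are
    distinct for distinct P over the same p because Z[x] + I is everything;
    [tau] bounds how many such P of a given degree there can be.

    Conversely, give the primes P distinct polynomials q_P <> 'X of the right
    degree.  A root of q_P modulo P is simple, so it lifts to an x_P with q_P(x_P)
    in P but not in P^2, and the Chinese remainder theorem yields one x for all
    P.  Let S = Z[x] + I.  Then S + P = R, and S :&: P is contained neither in
    P^2 nor in any other prime Q containing I.  If S were not R, a maximal proper
    S-submodule B of R containing S would have a conductor J = {a | aR <= B},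
    contained in some P; by maximality J contains S :&: P, so invertibility
    of P forces J = P, whence R = S + P <= B.

    In a ring of integers, a prime P containing d <> 0 is invertible: some z
    outside (d) satisfies zP <= (d), and if y = z/d mapped P into itself, two of
    the elements d y^k would agree modulo (d), so y would be integral. *)

Set Implicit Arguments.
Unset Strict Implicit.
Unset Printing Implicit Defensive.

Import GRing.Theory.

Local Open Scope ring_scope.

(** * Polynomials over finite fields *)

Section FiniteFieldPoly.
Variables (k F : finFieldType) (iota : {rmorphism k -> F}).
Implicit Types (q h : {poly k}) (a : F).
Local Notation "q ^i" := (map_poly iota q) (at level 2, format "q ^i").

(** If [q] does not divide [h], the two are coprime; coprimality survives the extension of scalars
    and excludes a common root. *)
Lemma root_irreducible q a h : irreducible_poly q ->
  root q^i a -> root h^i a = (q %| h).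
Proof.
move=> qirr qa; apply/idP/idP => [ha|]; last first.
  by move=> /dvdpP[r ->]; rewrite rmorphM rootM qa orbT.
case: (boolP (q %| h)) => // nqh.
have : coprimep q h by rewrite irreducible_poly_coprime.
rewrite -(coprimep_map iota) => /coprimep_root/(_ qa).
by rewrite -rootE ha.
Qed.

Lemma exists_min_polynomial a :
  exists q, [/\ q \is monic, irreducible_poly q & root q^i a].
Proof.
pose P n := [exists q : {poly_n k}, ((q : {poly k}) != 0) &&
  root (q : {poly k})^i a].
have exP : exists n, P n.
  (* This polynomial vanishes on all of [F], so some length bound admits a nonzero polynomial that
     kills [a]; the least such bound is taken next. *)
  pose h : {poly k} := 'X^#|F| - 'X.
  have sh : size h = #|F|.+1.
    rewrite size_polyDl ?size_polyXn // size_polyN size_polyX.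
    by rewrite ltnS finNzRing_gt1.
  exists #|F|.+1; apply/existsP; exists (npolyp _ h).
  rewrite npolypK ?sh // -size_poly_eq0 sh /=.
  by rewrite rootE rmorphB /= map_polyXn map_polyX !hornerE expf_card subrr.
have [n /existsP[q /andP[q0 qa]] nmin] := ex_minnP exP.
have min_size h : h != 0 -> root h^i a -> (size q <= size h)%N.
  move=> h0 ha; apply: leq_trans (size_npoly q) (nmin _ _).
  by apply/existsP; exists (npolyp _ h); rewrite npolypK // h0.
set c := lead_coef (q : {poly k}).
have c0 : c^-1 != 0 by rewrite invr_eq0 lead_coef_eq0.
exists (c^-1 *: (q : {poly k})); split.
- by rewrite monicE lead_coefZ mulVf ?lead_coef_eq0.
- split=> [|d d1].
    rewrite size_scale // ltnNge; apply/negP => /size1_polyC qE.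
    move: qa q0; rewrite qE map_polyC rootE hornerC fmorph_eq0 polyC_eq0.
    by move=> ->.
  rewrite dvdpZr // => dq; rewrite eqp_sym (eqp_trans (eqp_scale _ c0)) //.
  rewrite eqp_sym -dvdp_size_eqp // eqn_leq dvdp_leq //=.
  have /dvdpP[r qE] := dq.
  have : root (r * d)^i a by rewrite -qE.
  have r0 : r != 0 by apply: contraNneq q0 => r0; rewrite qE r0 mul0r.
  have d0 : d != 0 by apply: contraNneq q0 => d0; rewrite qE d0 mulr0.
  (* One of [r], [d] vanishes at [a] and so is at least as long as [q]. For [r] this would make [d]
     constant, against [d1]. *)
  rewrite rmorphM rootM => /orP[/(min_size _ r0)|/(min_size _ d0)//].
  rewrite {1}qE size_mul //.
  move: d1; rewrite -[size r]prednK ?size_poly_gt0 // -[size d]prednK ?size_poly_gt0 //.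
  rewrite addSn addnS /= ltnS -[leqRHS]addn0 leq_add2l leqn0 eqSS.
  by move=> /negbTE->.
- by rewrite map_polyZ rootZ // fmorph_eq0.
Qed.

Section IrreducibleRoot.
Variables (q : {poly k}) (a : F).
Hypotheses (q_irr : irreducible_poly q) (qa : root q^i a).

(** The domain consists of the remainders modulo [q], of which there are [#|k| ^ deg q]; evaluation
    at [a] is injective on them, so the size of [F] decides surjectivity. *)
Let ev (h : {poly_(size q).-1 k}) : F := (h : {poly k})^i.[a].

Let ev_inj : injective ev.
Proof.
have q0 := irredp_neq0 q_irr.
move=> h1 h2 eqh; apply/val_inj/eqP; rewrite -subr_eq0 /=.
have : root ((h1 : {poly k}) - (h2 : {poly k}))^i a.
  by rewrite rootE rmorphB hornerD hornerN subr_eq0; apply/eqP.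
rewrite (root_irreducible _ q_irr qa); apply: contraTT => h0.
apply/negP => /(dvdp_leq h0); rewrite leqNgt => /negP; apply.
apply: leq_ltn_trans (size_polyD _ _) _; rewrite size_polyN gtn_max.
by rewrite !(leq_ltn_trans (size_npoly _)) // ltn_predL size_poly_gt0.
Qed.

Lemma card_root_generated :
  (forall y, exists h : {poly k}, h^i.[a] = y) ->
  #|F| = (#|k| ^ (size q).-1)%N.
Proof.
have q0 := irredp_neq0 q_irr.
move=> a_gen; rewrite -card_npoly -(card_codom ev_inj); apply: eq_card => y.
apply/esym; have [h <-] := a_gen y; apply/codomP; exists (npolyp _ (h %% q)).
rewrite /ev npolypK; last by rewrite -ltnS prednK ?size_poly_gt0 // ltn_modpN0.
rewrite {1}(divp_eq h q) rmorphD rmorphM hornerD hornerM.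
by rewrite (rootP qa) mulr0 add0r.
Qed.

Lemma root_generates : #|F| = (#|k| ^ (size q).-1)%N ->
  forall y, exists h : {poly k}, h^i.[a] = y.
Proof.
move=> cF y; have [|g _ evK] := inj_card_bij ev_inj.
  by rewrite cF card_npoly.
by exists (g y : {poly k}); apply: evK.
Qed.

End IrreducibleRoot.

(** In the field [k[X]/(q)], which has [#|k| ^ deg q] elements, every element, in particular the
    class of ['X], is fixed by raising to that power. *)
Lemma irreducible_dvdp_genPoly q : q \is monic -> irreducible_poly q ->
  q %| 'X^(#|k| ^ (size q).-1) - 'X.
Proof.
move=> q_mon q_irr.
have mi : monic_irreducible_poly q by [].
have := expf_card (qpolyX q : {poly %/ q with mi}); rewrite card_qfpoly => XN.
have : in_qpoly q ('X^(#|k| ^ (size q).-1) - 'X) = 0.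
  by apply/eqP; rewrite rmorphB rmorphXn subr_eq0 /=; apply/eqP.
move=> /(congr1 val) /=; rewrite (mk_monicE mi) => XN0.
by rewrite Pdiv.Idomain.dvdpE /Pdiv.Ring.rdvdp; apply/eqP.
Qed.

(** [q] divides ['X^#|F| - 'X], which vanishes on all of [F]. Without a root of [q], the cofactor
    would have [#|F|] roots, more than its degree. *)
Lemma irreducible_has_root q : q \is monic -> irreducible_poly q ->
  #|F| = (#|k| ^ (size q).-1)%N -> exists a, root q^i a.
Proof.
move=> q_mon q_irr cF; have := irreducible_dvdp_genPoly q_mon q_irr.
rewrite -cF => /dvdpP[h hE].
have sX : size ('X^#|F| - 'X : {poly k}) = #|F|.+1.
  rewrite size_polyDl ?size_polyXn // size_polyN size_polyX.
  by rewrite ltnS finNzRing_gt1.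
have h0 : h != 0.
  apply/eqP => h0; move: hE; rewrite h0 mul0r => /(congr1 (size \o polyseq)) /=.
  by rewrite sX size_poly0.
suff : [exists a, root q^i a] by case/existsP => a; exists a.
apply: contraT => /existsPn noroot.
have : (#|F| < size h^i)%N.
  rewrite cardE; apply: max_poly_roots; rewrite ?map_poly_eq0 ?enum_uniq //.
  apply/allP => x _; have : root (h * q)^i x.
    rewrite -hE rmorphB /= map_polyXn map_polyX rootE !hornerE.
    by rewrite expf_card subrr.
  by rewrite rmorphM rootM (negbTE (noroot x)) orbF.
rewrite size_map_poly ltnNge => /negP[].
rewrite -ltnS -sX hE size_mul ?(irredp_neq0 q_irr) //.
have [q1 _] := q_irr; rewrite -[size q]prednK ?(ltnW q1) // addnS /=.
by rewrite -addn1 leq_add2l -ltnS prednK // ltnW.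
Qed.

(** Differentiating ['X^N - 'X = h * q] at [a], where [N] is zero in [k], gives
    [-1 = h(a) * q'(a)]. *)
Lemma irreducible_root_deriv q a : q \is monic -> irreducible_poly q ->
  root q^i a -> ~~ root (q^`())^i a.
Proof.
move=> q_mon q_irr qa; have := irreducible_dvdp_genPoly q_mon q_irr.
move=> /dvdpP[h /(congr1 (fun r => (r^`())^i.[a]))].
rewrite derivM rmorphD !rmorphM /= hornerD !hornerM (rootP qa) mulr0 add0r.
rewrite derivB derivXn derivX.
have -> : 'X^((#|k| ^ (size q).-1).-1) *+ (#|k| ^ (size q).-1) = 0 :> {poly k}.
  have [q1 _] := q_irr.
  have k0 : #|k|%:R = 0 :> k.
    have := cyclic.expg_cardG (finset.in_setT (1 : k)).
    by rewrite finalg.FinRing.zmodXgE cardsT.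
  rewrite -mulr_natr -polyC_natr natrX k0.
  by case: (size q) q1 => [|[|n]] // _; rewrite exprS mul0r mulr0.
rewrite sub0r rmorphN rmorph1 hornerN hornerC => /eqP.
by apply: contraTN => /rootP->; rewrite mulr0 oppr_eq0 oner_eq0.
Qed.
End FiniteFieldPoly.

(** These are the possible minimal polynomials of a generator modulo a prime ideal. ['X] is left out
    because a ring without unit generated by an element of [P] stays inside [P]. *)
Definition eligible (p f : nat) : {set {poly_(f.+1) 'F_p}} :=
  [set q : {poly_(f.+1) 'F_p} | [&& size q == f.+1,
      (q : {poly 'F_p}) \is monic, irreducibleb (q : {poly 'F_p}) &
      (q : {poly 'F_p}) != 'X]].

(** In degree 1 there are [p] polynomials ['X - c], and ['X] is one of them; in higher degree
    excluding ['X] removes nothing. *)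
Lemma card_eligible p f : prime p -> (0 < f)%N -> #|eligible p f|.+1 = tau p f.
Proof.
move=> p_pr f0; rewrite /tau; case: (eqVneq f 1%N) => [->|f1].
  have sXc (c : 'F_p) : (size ('X - c%:P)%R <= 2)%N by rewrite size_XsubC.
  pose lin c : {poly_2 'F_p} := npolyp 2 ('X - c%:P).
  have linE c : lin c = 'X - c%:P :> {poly 'F_p} by rewrite npolypK.
  have lin_inj : injective lin.
    move=> c d /(congr1 val); rewrite /= !linE => /(congr1 (fun q => - q.[0])).
    by rewrite !hornerE /= !opprK.
  have -> : eligible p 1 = lin @: [set~ 0].
    apply/setP => q; rewrite inE; apply/idP/imsetP => [|[c]]; last first.
      rewrite !inE => c0 ->; rewrite linE size_XsubC monicXsubC /=.
      rewrite (introT (irreducibleP _) (irredp_XsubC c)) /=.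
      by apply: contra c0 => /eqP/(congr1 (fun q => q.[0])); rewrite !hornerE => /eqP;
        rewrite oppr_eq0.
    case/and4P => /eqP sq q_mon _ qX.
    have qE : (q : {poly 'F_p}) = 'X - (- (q : {poly 'F_p})`_0)%:P.
      apply/polyP => -[|[|i]]; rewrite coefB coefX coefC /=.
      - by rewrite sub0r opprK.
      - by move: q_mon; rewrite monicE lead_coefE sq => /eqP->; rewrite subr0.
      - by rewrite nth_default ?sq ?subr0.
    exists (- (q : {poly 'F_p})`_0); last by apply/val_inj; rewrite /= linE -qE.
    by rewrite !inE; apply: contra qX => /eqP q0; rewrite qE q0 subr0.
  rewrite card_imset // cardsC1 card_Fp // prednK // prime_gt0 //.
congr _.+1; apply: eq_card => q; rewrite !inE.
case: eqP => //= sq; case: (_ \is monic) => //=.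
case: irreducibleb => //=; apply: contra_neq f1 => qX.
by move: sq; rewrite qX size_polyX => -[].
Qed.

Local Open Scope classical_set_scope.
Local Open Scope quotient_scope.

(** * Residue fields *)

(** Finiteness of [R/I], stated by a list of representatives so that no finite type has to be put on
    the quotient. *)
Definition finite_index (R : comNzRingType) (I : ideal R) : Prop :=
  exists L : seq R, forall a, exists2 l, l \in L & a - l \in ideal_mem I.

Section Basics.
Variable R : comNzRingType.
Implicit Types (I P : ideal R) (a b : R).

Lemma ideal_mulr I a u : u \in ideal_mem I -> u * a \in ideal_mem I.
Proof. by rewrite mulrC; apply: ideal_mull. Qed.

Lemma ideal_memE I a : (a \in ideal_mem I) = (a \in ideal_set I).
Proof. by []. Qed.

Lemma ideal_memP I a : reflect (ideal_set I a) (a \in ideal_mem I).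
Proof. by rewrite ideal_memE; apply: (iffP idP) => [/set_mem|/mem_set]. Qed.

Lemma finite_index_sub I P :
  {subset ideal_mem I <= ideal_mem P} -> finite_index I -> finite_index P.
Proof. by move=> sIP [L HL]; exists L => a; have [l ? /sIP] := HL a; exists l. Qed.

Lemma finite_index_pigeonhole I (u : nat -> R) : finite_index I ->
  exists i j, (i < j)%N /\ u i - u j \in ideal_mem I.
Proof.
move=> [L HL]; have HL' a : exists l, (l \in L) && (a - l \in ideal_mem I).
  by have [l ? ?] := HL a; exists l; apply/andP.
pose c n := xchoose (HL' (u n)).
have cL n : c n \in L by have /andP[] := xchooseP (HL' (u n)).
have cu n : u n - c n \in ideal_mem I by have /andP[] := xchooseP (HL' (u n)).
have /(uniqPn 0)[i [j [ij js eqc]]] : ~~ uniq (mkseq c (size L).+1).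
  apply/negP => /uniq_leq_size cs; have /cs : {subset mkseq c (size L).+1 <= L}.
    by move=> _ /mapP[n _ ->].
  by rewrite size_mkseq ltnn.
exists i, j; split=> //; rewrite size_mkseq in js.
have ->: u i - u j = (u i - c i) - (u j - c j).
  rewrite !nth_mkseq // ?(ltn_trans ij) // in eqc.
  by rewrite eqc opprB addrA subrK.
by rewrite rpredB.
Qed.

Lemma prime_ideal1 P : prime_ideal P -> 1 \notin ideal_mem P.
Proof. by case. Qed.

Lemma prime_idealM P a b : prime_ideal P ->
  (a * b \in ideal_mem P) = (a \in ideal_mem P) || (b \in ideal_mem P).
Proof.
case=> _ Pp; apply/idP/orP => [/Pp/orP//|[] aP]; first exact: ideal_mulr.
exact: ideal_mull.
Qed.

Lemma prime_idealX P a n : prime_ideal P -> a ^+ n \in ideal_mem P -> a \in ideal_mem P.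
Proof.
move=> Pp; elim: n => [|n IHn]; first by rewrite expr0 (negPf (prime_ideal1 Pp)).
by rewrite exprS prime_idealM // => /orP[].
Qed.

(** A finite domain is a field: two powers of [a] agree modulo [P], and the common power cancels. *)
Lemma prime_ideal_max P a : prime_ideal P -> finite_index P ->
  a \notin ideal_mem P -> exists b, 1 - b * a \in ideal_mem P.
Proof.
move=> Pp Pfin aP; have [i [j [ij]]] := finite_index_pigeonhole (GRing.exp a) Pfin.
rewrite -(subnK ij) addnS exprS exprD.
have -> : a ^+ i - a * (a ^+ (j - i.+1) * a ^+ i) =
    a ^+ i * (1 - a ^+ (j - i.+1) * a).
  by ring.
rewrite prime_idealM // => /orP[/(prime_idealX Pp)|]; first by rewrite (negPf aP).
by exists (a ^+ (j - i.+1)).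
Qed.

End Basics.

Section ResidueField.
Variables (R : comNzRingType) (P : ideal R).
Hypotheses (P_prime : prime_ideal P) (P_fin : finite_index P).

(** The two proofs are arguments of the alias so that the field and finite type instances, which
    depend on them, can be attached to it. *)
Definition residue of prime_ideal P & finite_index P : Type := quotient P.
Local Notation T := (residue P_prime P_fin).

HB.instance Definition _ := GRing.ComPzRing.on T.

Definition residue_map (a : R) : T := \pi_(quotient P) a.

Lemma residue_map_zmod : zmod_morphism residue_map.
Proof.
move=> a b; apply/eqP; rewrite eq_sym subr_eq; apply/eqP.
by apply: etrans (esym (quotient_addE _ _ _)); rewrite subrK.
Qed.

Lemma residue_map_monoid : monoid_morphism residue_map.
Proof. by split=> // a b; apply/esym/(quotient_mulE P). Qed.

HB.instance Definition _ := GRing.isZmodMorphism.Build R T residue_map residue_map_zmod.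
HB.instance Definition _ := GRing.isMonoidMorphism.Build R T residue_map residue_map_monoid.

Lemma residue_map_eq0 a : (residue_map a == 0) = (a \in ideal_mem P).
Proof.
have -> : (0 : T) = \pi_(quotient P) 0 by rewrite -(rmorph0 residue_map).
by rewrite -[LHS](quotient_eqP P) subr0.
Qed.

Lemma residue_map_surj (y : T) : exists a, residue_map a = y.
Proof. by exists (repr (y : quotient P)); apply: (reprK (y : quotient P)). Qed.

Lemma residue_nonzero : 1 != 0 :> T.
Proof.
by rewrite -(rmorph1 residue_map) residue_map_eq0 (prime_ideal1 P_prime).
Qed.

HB.instance Definition _ := GRing.PzSemiRing_isNonZero.Build T residue_nonzero.

Lemma residue_inverse (x : T) : x != 0 -> exists y, y * x = 1.
Proof.
have [a <-] := residue_map_surj x; rewrite residue_map_eq0.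
move=> /(prime_ideal_max P_prime P_fin)[b].
rewrite -residue_map_eq0 rmorphB rmorph1 rmorphM subr_eq0 => /eqP ba.
by exists (residue_map b).
Qed.

(** The default value 0 is the inverse of 0 that a field structure requires. *)
Definition residue_inv (x : T) : T := xget 0 [set y | y * x = 1].

Lemma residue_mulVf x : x != 0 -> residue_inv x * x = 1.
Proof.
move=> /residue_inverse[y yx1]; rewrite /residue_inv.
by case: xgetP => [z _ //|/(_ y)].
Qed.

Lemma residue_inv0 : residue_inv 0 = 0.
Proof.
rewrite /residue_inv; case: xgetP => // z _ /= /eqP.
by rewrite mulr0 eq_sym oner_eq0.
Qed.

HB.instance Definition _ :=
  GRing.ComNzRing_isField.Build T residue_mulVf residue_inv0.

Lemma residue_finite_set : finite_set [set: T].
Proof.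
have [L HL] := P_fin; apply: (@sub_finite_set _ _ [set` map residue_map L]).
  move=> y _ /=; have [a <-] := residue_map_surj y.
  have [l lL] := HL a; rewrite -residue_map_eq0 rmorphB subr_eq0 => /eqP->.
  exact: map_f.
exact: finite_seq.
Qed.

Definition residue_enum : seq T := fset_set [set: T].

Lemma mem_residue_enum x : x \in residue_enum.
Proof.
by rewrite /residue_enum in_fset_set ?in_setT //; apply: residue_finite_set.
Qed.

Lemma residue_pickleK : pcancel (index^~ residue_enum) (onth residue_enum).
Proof.
move=> x; have xe := mem_residue_enum x.
by rewrite onthE (nth_map 0) ?index_mem // nth_index.
Qed.

HB.instance Definition _ := Choice_isCountable.Build T residue_pickleK.

Lemma residue_enumP : Finite.axiom residue_enum.
Proof. by apply: Finite.uniq_enumP; [apply: fset_uniq|apply: mem_residue_enum]. Qed.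

HB.instance Definition _ := isFinite.Build T residue_enumP.

End ResidueField.

(** From here on the residue field is only known as a finite field [F] with a surjection from [R] of
    kernel [P]. *)
Lemma residue_fieldP (R : comNzRingType) (P : ideal R) :
  prime_ideal P -> finite_index P ->
  exists (F : finFieldType) (psi : {rmorphism R -> F}),
    (forall y, exists a, psi a = y) /\
    forall a, (psi a == 0) = (a \in ideal_mem P).
Proof.
move=> pP fP; exists (residue pP fP : finFieldType), (residue_map pP fP).
by split; [apply: residue_map_surj | apply: residue_map_eq0].
Qed.

Section PrimeFieldEmbedding.
Variables (F : finFieldType) (p : nat).
Hypothesis p_char : p \in [pchar F].

Definition Fp_embed (c : 'F_p) : F := (c : nat)%:R.

Lemma Fp_embed_nat n : Fp_embed n%:R = n%:R.
Proof.
have p_pr := pcharf_prime p_char.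
rewrite /Fp_embed val_Fp_nat // [in RHS](divn_eq n p) natrD mulrnA.
by rewrite (mulrn_pchar p_char) add0r.
Qed.

Lemma Fp_embed_zmod : zmod_morphism Fp_embed.
Proof.
suff eD : {morph Fp_embed : a b / a + b}.
  by move=> a b; apply: (canRL (addrK _)); rewrite -eD subrK.
move=> a b; have -> : a + b = ((a : nat) + (b : nat))%:R.
  by rewrite natrD -{1}[a]natr_Zp -{1}[b]natr_Zp.
by rewrite Fp_embed_nat natrD.
Qed.

Lemma Fp_embed_monoid : monoid_morphism Fp_embed.
Proof.
split=> [|a b]; first by rewrite -[1]/(1%:R) Fp_embed_nat.
have -> : a * b = ((a : nat) * (b : nat))%:R.
  by rewrite natrM -{1}[a]natr_Zp -{1}[b]natr_Zp.
by rewrite Fp_embed_nat natrM.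
Qed.

HB.instance Definition _ := GRing.isZmodMorphism.Build 'F_p F Fp_embed Fp_embed_zmod.
HB.instance Definition _ := GRing.isMonoidMorphism.Build 'F_p F Fp_embed Fp_embed_monoid.

Definition Fp_morphism : {rmorphism 'F_p -> F} := Fp_embed.

End PrimeFieldEmbedding.

Section Residue.
Variables (R : comNzRingType) (P : ideal R) (F : finFieldType).
Variable psi : {rmorphism R -> F}.
Hypothesis psi_surj : forall y, exists a, psi a = y.
Hypothesis psi_ker : forall a, (psi a == 0) = (a \in ideal_mem P).

Lemma lies_overP p : prime p -> lies_over P p <-> p \in [pchar F].
Proof.
move=> p_pr; split=> [Pp|pF n].
  rewrite inE p_pr /= -(rmorph_nat psi) psi_ker ideal_memE.
  by have := Pp p; rewrite -pmulrn dvdzz => ->.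
rewrite -ideal_memE -psi_ker rmorph_int dvdzE absz_nat (dvdn_pcharf pF).
by case: n => n //; rewrite NegzE mulrNz oppr_eq0 abszN.
Qed.

(** The isomorphism from [quotient P] to [F] induced by [psi]; it carries the definition of the
    residual degree over to [F]. *)
Let theta (x : quotient P) : F := psi (repr x).

Let theta_pi a : theta (\pi_(quotient P) a) = psi a.
Proof.
apply/eqP; rewrite -subr_eq0 -rmorphB psi_ker.
by rewrite (quotient_eqP P); apply/eqP; apply: (reprK (_ : quotient P)).
Qed.

Let theta_inj : injective theta.
Proof.
move=> x y /eqP; rewrite -subr_eq0 -rmorphB psi_ker (quotient_eqP P).
rewrite (reprK (x : quotient P)) (reprK (y : quotient P)).
by move/eqP.
Qed.

Let theta_add : {morph theta : x y / x + y}.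
Proof.
move=> x y; rewrite -[x](reprK (x : quotient P)) -[y](reprK (y : quotient P)).
by rewrite quotient_addE !theta_pi rmorphD.
Qed.

Let theta0 : theta 0 = 0.
Proof. by apply: (addrI (theta 0)); rewrite -theta_add !addr0. Qed.

(** A basis puts [F] in bijection with its [p ^ f] coordinate families. Conversely [F] is a vector
    space over its prime field, of dimension [logn p #|F|], and a basis is pulled back along
    [theta]. *)
Lemma has_residual_degreeP p f : prime p -> p \in [pchar F] ->
  has_residual_degree P p f <-> #|F| = (p ^ f)%N.
Proof.
move=> p_pr pF; split=> [[b bP]|cF].
  pose e (c : {ffun 'I_f -> 'F_p}) := theta (\sum_(i < f) b i *+ (c i : nat)).
  have e_inj : injective e.
    move=> c d /theta_inj ecd.
    have [c0 [_ c0u]] := bP (\sum_(i < f) b i *+ (c i : nat)).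
    by rewrite -(c0u c) // -(c0u d).
  rewrite -[p in RHS]card_Fp // -[f in RHS]card_ord -card_ffun -(card_codom e_inj).
  apply: eq_card => y; apply/esym/codomP.
  have [a <-] := psi_surj y; rewrite -theta_pi.
  by have [c [-> _]] := bP (\pi_(quotient P) a); exists c.
have := pprimeChar_vectAxiom pF.
rewrite cF pfactorK // => -[v v_lin [w vK wK]].
have wit (i : 'I_f) : exists b : quotient P, v (theta b) = delta_mx 0 i.
  have [a ea] := psi_surj (w (delta_mx 0 i)).
  by exists (\pi_(quotient P) a); rewrite theta_pi ea wK.
have [b bP] := choice wit; exists b => x.
pose V : F -> 'rV['F_p]_f := v.
have VD : {morph V : y z / y + z}.
  by move=> y z; have := v_lin 1 y z; rewrite !scale1r.
have V0 : V 0 = 0 by apply: (addrI (V 0)); rewrite -VD !addr0.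
have VsumE (c : {ffun 'I_f -> 'F_p}) :
    V (theta (\sum_(i < f) b i *+ (c i : nat))) = \row_i c i.
  rewrite (big_morph theta theta_add theta0) (big_morph V VD V0).
  rewrite [RHS]row_sum_delta; apply: eq_bigr => i _; rewrite mxE.
  rewrite -[c i in RHS]natr_Zp scaler_nat -(bP i) -/V.
  elim: (c i : nat) => [|n IHn]; first by rewrite !mulr0n theta0 V0.
  by rewrite !mulrS theta_add VD IHn.
exists [ffun i => V (theta x) 0 i]; split.
  apply/theta_inj/(can_inj vK); rewrite -/V VsumE.
  by apply/rowP => i; rewrite mxE ffunE.
by move=> c ->; apply/ffunP => i; rewrite ffunE VsumE mxE.
Qed.
End Residue.

(** * Coverings and generators *)

Definition int_eval (R : comNzRingType) (x : R) (g : {poly int}) : R :=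
  (map_poly intr g).[x].

(** The factor [x] restricts to polynomials without constant term: their values form the subring
    generated by [x], which need not contain 1. *)
Definition generates (R : comNzRingType) (I : ideal R) (x : R) : Prop :=
  forall b, exists g, b - x * int_eval x g \in ideal_mem I.

Section IntEval.
Variables (R : comNzRingType) (x : R).

Lemma int_eval_zmod : zmod_morphism (int_eval x).
Proof. by move=> g h; rewrite /int_eval rmorphB hornerD hornerN. Qed.

Lemma int_eval_monoid : monoid_morphism (int_eval x).
Proof.
by split=> [|g h]; rewrite /int_eval ?rmorphM ?hornerM // rmorph1 hornerC.
Qed.

HB.instance Definition _ :=
  GRing.isZmodMorphism.Build {poly int} R (int_eval x) int_eval_zmod.
HB.instance Definition _ :=
  GRing.isMonoidMorphism.Build {poly int} R (int_eval x) int_eval_monoid.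

Lemma int_evalC c : int_eval x c%:P = c%:~R.
Proof. by rewrite /int_eval map_polyC hornerC. Qed.

Lemma int_evalX : int_eval x 'X = x.
Proof. by rewrite /int_eval map_polyX hornerX. Qed.

End IntEval.

Section Coverable.
Variables (R : comNzRingType) (I : ideal R).
Local Notation piI := (\pi_(quotient I)).

Lemma quotient_subE a b : piI a - piI b = piI (a - b).
Proof. by apply: (canLR (addrK _)); rewrite quotient_addE subrK. Qed.

Lemma subring_int_eval (S : set (quotient I)) x g : is_subring S ->
  piI x \in S -> piI (x * int_eval x g) \in S.
Proof.
move=> [[S0 SB] SM] xS.
have SN u : u \in S -> - u \in S by move=> uS; rewrite -sub0r; apply: SB.
have SD u v : u \in S -> v \in S -> u + v \in S.
  by move=> uS vS; rewrite -[v]opprK; apply: SB => //; apply: SN.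
have pi0 : piI 0 = 0 by apply: (addrI (piI 0)); rewrite quotient_addE !addr0.
have piN u : piI (- u) = - piI u.
  by apply: (addrI (piI u)); rewrite quotient_addE !subrr.
elim/poly_ind: g => [|g c IHg]; first by rewrite rmorph0 mulr0 pi0.
rewrite rmorphD rmorphM /= int_evalX int_evalC mulrDr -quotient_addE.
have Sn n : piI (x * n%:R) \in S.
  elim: n => [|n IHn]; first by rewrite mulr0 pi0.
  by rewrite mulrS mulrDr mulr1 -quotient_addE; apply: SD.
apply: SD; first by rewrite mulrA -quotient_mulE; apply: SM.
by case: c => n; rewrite ?NegzE ?mulrNz ?mulrN ?piN; [|apply: SN]; apply: Sn.
Qed.

(** A generator lies in no proper subring; without one, each element lies in the subring it
    generates, which is proper. *)
Lemma coverableP : coverable (quotient I) <-> ~ exists x, generates I x.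
Proof.
split=> [cov [x xgen]|ngen].
  have : [set: quotient I] (piI x) by [].
  rewrite -cov => -[S [Ssub Sneq] xS]; apply: Sneq; apply/seteqP; split=> // y _.
  have [g] := xgen (repr y); rewrite quotient_eqP (reprK y) => /eqP->.
  by rewrite -in_setE; apply: subring_int_eval => //; rewrite in_setE.
apply/seteqP; split=> // y _; set x := repr y.
exists [set z | exists g, z = piI (x * int_eval x g)]; last first.
  by exists 1; rewrite rmorph1 mulr1 /x (reprK y).
split; last first.
  move=> Sx; apply: ngen; exists x => b.
  have : [set: quotient I] (piI b) by [].
  by rewrite -Sx => -[g /eqP]; rewrite -quotient_eqP; exists g.
split=> [|u v]; last first.
  (* [(x g(x)) (x h(x)) = x (g(x) x h(x))]. *)
  rewrite !in_setE => -[g ->] [h ->]; exists (g * 'X * h).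
  apply: etrans (quotient_mulE _ _ _) _.
  by rewrite !rmorphM /= int_evalX; congr (piI _); ring.
split=> [|u v].
  rewrite in_setE; exists 0; rewrite rmorph0 mulr0.
  by apply: (addrI (piI 0)); rewrite quotient_addE !addr0.
rewrite !in_setE => -[g ->] [h ->]; exists (g - h).
by rewrite quotient_subE rmorphB mulrBr.
Qed.

End Coverable.

Lemma ideal_eq (R : comNzRingType) (P Q : ideal R) :
  ideal_mem P =i ideal_mem Q -> P = Q.
Proof.
case: P Q => [S S_ideal] [T T_ideal] eqST.
have eST : S = T.
  apply/predeqP => a; have := eqST a; rewrite !ideal_memE /= => ST.
  by split=> /mem_set; [rewrite ST | rewrite -ST] => /set_mem.
by case: T / eST T_ideal {eqST} => T_ideal; congr Ideal; apply: bool_irrelevance.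
Qed.

Lemma ideal_divides_sub (R : comNzRingType) (P I : ideal R) :
  ideal_divides P I -> {subset ideal_mem I <= ideal_mem P}.
Proof.
move=> [J IE] a; rewrite ideal_memE IE in_setE => -[n [u [v [uvP ->]]]].
by apply: rpred_sum => i _; apply: ideal_mulr; have [] := uvP i.
Qed.

Lemma residue_int_eval (R : comNzRingType) (F : fieldType) p
    (iota : {rmorphism 'F_p -> F}) (psi : {rmorphism R -> F}) x g :
  psi (int_eval x g) = (map_poly iota (map_poly intr g)).[psi x].
Proof.
rewrite /int_eval -horner_map -!map_poly_comp; congr (_.[_]).
by apply: eq_map_poly => c /=; rewrite !rmorph_int.
Qed.

Lemma reduction_surj p (h : {poly 'F_p}) :
  exists g : {poly int}, map_poly intr g = h.
Proof.
exists (map_poly (fun c : 'F_p => (c : nat)%:Z) h).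
apply/polyP => i.
by rewrite coef_map coef_map_id0 //= -pmulrn natr_Zp.
Qed.

(** * Faulty ideals have no generator *)

Section Faulty.
Variables (R : comNzRingType) (I : ideal R).
Hypothesis I_fin : finite_index I.

(** [q] is the minimal polynomial over ['F_p] of the image of [x]. That image generates the residue
    field, whence the degree [f], and it divides 1, whence [q] is not ['X]. *)
Lemma generator_polynomial (P : ideal R) p f x :
    prime p -> prime_ideal P -> lies_over P p -> has_residual_degree P p f ->
    {subset ideal_mem I <= ideal_mem P} -> generates I x ->
  exists q, q \in eligible p f /\
    forall g, (int_eval x g \in ideal_mem P) =
              ((q : {poly 'F_p}) %| map_poly intr g).
Proof.
move=> p_pr P_pr Pp Pf IP x_gen.
have [F [psi [psi_surj psi_ker]]] := residue_fieldP P_pr (finite_index_sub IP I_fin).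
have p_char : p \in [pchar F] by apply/(lies_overP psi_ker).
have [iota _] : exists iota : {rmorphism 'F_p -> F}, True.
  by exists (Fp_morphism p_char).
have cF := (has_residual_degreeP psi_surj psi_ker f p_pr p_char).1 Pf.
have psi_gen b : exists g, psi b = psi x * psi (int_eval x g).
  have [g /IP] := x_gen b; rewrite -psi_ker rmorphB subr_eq0 => /eqP->.
  by exists g; rewrite rmorphM.
have [q [q_mon q_irr qx]] := exists_min_polynomial iota (psi x).
have /(card_root_generated q_irr qx) : forall y, exists h : {poly 'F_p},
    (map_poly iota h).[psi x] = y.
  move=> y; have [b <-] := psi_surj y; have [g ->] := psi_gen b.
  exists ('X * map_poly intr g).
  by rewrite rmorphM /= map_polyX hornerM hornerX -residue_int_eval.
rewrite cF card_Fp // => /(expnI (prime_gt1 p_pr)) fE.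
have [q1 _] := q_irr.
have sq : size q = f.+1 by rewrite fE prednK // ltnW.
exists (npolyp f.+1 q); rewrite npolypK ?sq //; split.
  rewrite inE npolypK ?sq // eqxx q_mon (introT (irreducibleP _) q_irr) /=.
  apply: contraTneq isT => qX; move: qx; rewrite qX map_polyX rootE hornerX.
  move=> /eqP x0; have [g /eqP] := psi_gen 1.
  by rewrite x0 mul0r rmorph1 oner_eq0.
move=> g; rewrite -psi_ker (residue_int_eval iota).
by rewrite -(root_irreducible _ q_irr qx).
Qed.

(** Given a generator, the minimal polynomial determines the prime ideal, so the primes counted by
    [num_prime_divisors I p f] inject into [eligible p f], which has [tau p f - 1] elements. *)
Lemma faulty_not_generated : faulty I -> ~ exists x, generates I x.
Proof.
move=> [p [f [p_pr f0 tau_le]]] [x x_gen].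
move: tau_le; rewrite leqNgt => /negP; apply; rewrite -card_eligible // ltnS.
rewrite /num_prime_divisors; set D := [set P : ideal R | _].
(* On an infinite set [fset_set] is empty, and the bound is trivial. *)
have [D_fin|D_inf] := pselect (finite_set D); last first.
  have -> : fset_set D = fset0 by rewrite /fset_set; case: pselect.
  by rewrite cardfs0.
have wit (P : ideal R) : exists q : {poly_(f.+1) 'F_p}, D P ->
    q \in eligible p f /\ forall g, (int_eval x g \in ideal_mem P) =
              ((q : {poly 'F_p}) %| map_poly intr g).
  have [DP|] := pselect (D P); last by exists 0.
  case: (DP) => P_pr Pp /ideal_divides_sub IP Pf.
  by have [q qP] := generator_polynomial p_pr P_pr Pp Pf IP x_gen; exists q.
have [q qP] := choice wit.
have memD P : (P \in fset_set D) -> D P by rewrite in_fset_set // inE.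
have q_inj : {in fset_set D &, injective q}.
  have sub P Q : D P -> D Q -> q P = q Q -> {subset ideal_mem P <= ideal_mem Q}.
    move=> DP DQ qPQ b bP; have [g bg] := x_gen b.
    have [[_ qPE] [_ qQE]] := (qP P DP, qP Q DQ).
    case: (DP) (DQ) => _ _ /ideal_divides_sub IP _ [_ _ /ideal_divides_sub IQ _].
    (* Modulo [I] the element [b] is the value at [x] of ['X * g], so whether [b] lies in [P] is
       decided by divisibility by the polynomial of [P], which is also that of [Q]. *)
    have gP : int_eval x ('X * g) \in ideal_mem P.
      rewrite rmorphM /= int_evalX -[_ * _](subKr b).
      exact: rpredB bP (IP _ bg).
    rewrite -[b](subrK (x * int_eval x g)) (rpredD (IQ _ bg)) //.
    by rewrite qPE qPQ -qQE rmorphM /= int_evalX in gP.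
  move=> P Q /memD DP /memD DQ qPQ; apply: ideal_eq => b.
  by apply/idP/idP; apply: sub.
rewrite cardE -(size_map q); apply: uniq_leq_size.
  by rewrite map_inj_in_uniq // fset_uniq.
by move=> _ /mapP[P /memD DP ->]; rewrite mem_enum; have [] := qP P DP.
Qed.
End Faulty.

(** * Constructing a generator *)

Section Maximal.
Variables (R : comNzRingType) (I : ideal R).
Hypothesis I_fin : finite_index I.

Lemma count_eq_sub (T : eqType) (a b : pred T) s : subpred a b ->
  (count b s <= count a s)%N -> forall z, z \in s -> b z -> a z.
Proof.
move=> sab; elim: s => //= y s IHs cs z.
have cab := sub_count sab s.
case ay : (a y) cs; last case by_ : (b y) => //=.
- rewrite (sab _ ay) leq_add2l => cs; rewrite inE => /orP[/eqP->//|]; exact: IHs.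
- by rewrite add0n => /leq_trans/(_ cab); rewrite ltnn.
- by rewrite !add0n => cs; rewrite inE => /orP[/eqP->|]; [rewrite by_|exact: IHs].
Qed.

(** A finite substitute for Zorn's lemma: the sets satisfying [Phi] are unions of the finitely many
    classes modulo [I], so one that contains the most representatives is maximal. *)
Lemma exists_maximal_set (Phi : set R -> Prop) (B0 : set R) :
    (forall B a c, Phi B -> c - a \in ideal_mem I -> B a -> B c) ->
    Phi B0 ->
  exists B, [/\ Phi B, B0 `<=` B & forall C, Phi C -> B `<=` C -> C `<=` B].
Proof.
move=> sat PhiB0; have [L HL] := I_fin.
pose mu (B : set R) := count (fun l => `[<B l>]) L.
pose good n := `[< exists B, [/\ Phi B, B0 `<=` B & mu B = n] >].
have ex_good : exists n, good n.
  by exists (mu B0); apply/asboolP; exists B0; split.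
have good_le n : good n -> (n <= size L)%N.
  by move=> /asboolP[B [_ _ <-]]; apply: count_size.
case: (ex_maxnP ex_good good_le) => n /asboolP[B [PhiB B0B muB]] n_max.
exists B; split=> // C PhiC BC c Cc; have [l lL cl] := HL c.
apply: (sat B l) => //; apply/asboolP.
apply: (@count_eq_sub _ (fun l => `[<B l>]) (fun l => `[<C l>]) L) => //.
- by move=> r /asboolP Br; apply/asboolP/BC.
- rewrite -/(mu B) -/(mu C) muB; apply: n_max; apply/asboolP; exists C.
  by split=> // r /B0B; apply: BC.
- by apply/asboolP; apply: (sat C c) => //; rewrite -opprB rpredN.
Qed.

End Maximal.

Lemma ideal_of_set (R : comNzRingType) (S : set R) :
  S 0 -> (forall a b, S a -> S b -> S (a - b)) ->
  (forall a b, S b -> S (a * b)) -> exists J : ideal R, ideal_set J = S.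
Proof.
move=> S0 SB SM; have S_ideal : is_ideal S.
  split; last by move=> a b /set_mem/(SM a)/mem_set.
  by split=> [|a b /set_mem Sa /set_mem Sb]; apply/mem_set; [|apply: SB].
by exists (Ideal (asboolT S_ideal)).
Qed.

Lemma exists_prime_above (R : comNzRingType) (J : ideal R) :
  finite_index J -> 1 \notin ideal_mem J ->
  exists P, prime_ideal P /\ {subset ideal_mem J <= ideal_mem P}.
Proof.
move=> J_fin J1.
pose Phi (B : set R) := exists M : ideal R,
  [/\ ideal_set M = B, 1 \notin ideal_mem M & {subset ideal_mem J <= ideal_mem M}].
have [||B [[M [<- M1 JM]] _ Mmax]] := @exists_maximal_set R J J_fin Phi J.
  move=> B a c [M [<- _ JM]] /JM ca /ideal_memP Ma; apply/ideal_memP.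
  by rewrite -[c](subrK a) rpredD.
  by exists J; split.
suff M_prime u v : u * v \in ideal_mem M -> u \notin ideal_mem M ->
    v \in ideal_mem M.
  exists M; split=> //; split=> // u v uvM; apply/orP.
  by case: (boolP (u \in ideal_mem M)) => uM; [left|right; apply: M_prime uvM uM].
move=> uvM uM.
have [||| C CE] := @ideal_of_set R [set m + u * r | m in ideal_set M & r in [set: R]].
- by exists 0; [exact/ideal_memP/rpred0|exists 0; rewrite // mulr0 addr0].
- move=> _ _ [m1 /ideal_memP Mm1 [r1 _ <-]] [m2 /ideal_memP Mm2 [r2 _ <-]].
  exists (m1 - m2); first exact/ideal_memP/rpredB.
  by exists (r1 - r2) => //; ring.
- move=> a _ [m /ideal_memP Mm [r _ <-]].
  exists (a * m); first exact/ideal_memP/ideal_mull.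
  by exists (a * r) => //; ring.
have MC : ideal_set M `<=` C.
  by rewrite CE => m Mm; exists m => //; exists 0; rewrite // mulr0 addr0.
case: (boolP (1 \in ideal_mem C)) => [|C1].
  move/ideal_memP; rewrite CE => -[m /ideal_memP Mm [r _ mr]].
  (* From [1 = m + u r] follows [v = m v + (u v) r], where [u v] is in [M]. *)
  rewrite -[v]mul1r -mr mulrDl; apply: rpredD; first exact: ideal_mulr.
  by rewrite mulrAC ideal_mulr.
have /Mmax/(_ MC) CM : Phi C.
  by exists C; split=> // a /JM/ideal_memP/MC/ideal_memP.
case/negP: uM; apply/ideal_memP/CM; rewrite CE.
by exists 0; [exact/ideal_memP/rpred0|exists 1; rewrite // mulr1 add0r].
Qed.

(* [phi] plays the role of multiplication by an element of the inverse of P; the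
   last condition says that P times its inverse is the whole ring. *)
Definition is_dual (R : comNzRingType) (P : ideal R) (phi : R -> R) : Prop :=
  [/\ forall t u, t \in ideal_mem P -> u \in ideal_mem P ->
        phi (t + u) = phi t + phi u,
      forall r t, t \in ideal_mem P -> phi (r * t) = r * phi t &
      exists2 b, b \in ideal_mem P & 1 - phi b \in ideal_mem P].

Definition invertible (R : comNzRingType) (P : ideal R) : Prop :=
  exists phi, is_dual P phi.

Section Dual.
Variables (R : comNzRingType) (P : ideal R) (phi : R -> R).
Hypothesis phi_dual : is_dual P phi.
Implicit Types (t u r : R).

Let phiD t u : t \in ideal_mem P -> u \in ideal_mem P ->
  phi (t + u) = phi t + phi u.
Proof. by case: phi_dual => H _ _; apply: H. Qed.

Let phiM r t : t \in ideal_mem P -> phi (r * t) = r * phi t.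
Proof. by case: phi_dual => _ H _; apply: H. Qed.

Lemma dualMC t u : t \in ideal_mem P -> u \in ideal_mem P ->
  t * phi u = phi t * u.
Proof. by move=> tP uP; rewrite -phiM // mulrC phiM // mulrC. Qed.

Lemma dualB t u : t \in ideal_mem P -> u \in ideal_mem P ->
  phi (t - u) = phi t - phi u.
Proof. by move=> tP uP; rewrite -mulN1r phiD ?ideal_mull // phiM // mulN1r. Qed.

(** The cofactor is the ideal quotient [J = (I : P)]. It contains [i] and [phi i] for [i] in [I],
    and [i = (1 - phi b) i + b (phi i)] exhibits [i] in [P J]. *)
Lemma invertible_divides I :
  {subset ideal_mem I <= ideal_mem P} -> ideal_divides P I.
Proof.
move=> IP; have [_ _ [b bP phib]] := phi_dual.
have [||| J JE] := @ideal_of_set R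
  [set z | forall t, t \in ideal_mem P -> z * t \in ideal_mem I].
- by move=> t _; rewrite mul0r rpred0.
- by move=> u v Ju Jv t tP; rewrite mulrBl; apply: rpredB; [apply: Ju|apply: Jv].
- by move=> u v Jv t tP; rewrite -mulrA; apply: ideal_mull; apply: Jv.
exists J; apply/seteqP; split=> [i /ideal_memP iI|_ [n [u [v [uvP ->]]]]]; last first.
  apply/ideal_memP; apply: rpred_sum => k _; have [uP] := uvP k.
  by rewrite mulrC JE => /set_mem vJ; apply: vJ.
have iP := IP _ iI.
exists 2%N, (fun k => if k == ord0 then 1 - phi b else b).
exists (fun k => if k == ord0 then i else phi i); split=> [k|]; last first.
  by rewrite !big_ord_recl big_ord0 /= addr0 dualMC // mulrBl mul1r subrK.
rewrite JE; case: eqP => _; split=> //; apply/mem_set => t tP; first exact: ideal_mulr.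
by rewrite -dualMC //; apply: ideal_mulr.
Qed.

(** The ideal [C = J + phi(J)] lies in no prime: such a prime contains [J], so it is [P], yet
    [phi j] is not in [P]. Hence [1 = u + phi v], and [t = t u + (phi t) v] is in [J] for each [t]
    in [P]. *)
Lemma invertible_eq J : {subset ideal_mem J <= ideal_mem P} ->
    finite_index J ->
    (exists2 j, j \in ideal_mem J & phi j \notin ideal_mem P) ->
    (forall Q, prime_ideal Q -> {subset ideal_mem J <= ideal_mem Q} -> Q = P) ->
  {subset ideal_mem P <= ideal_mem J}.
Proof.
move=> JP J_fin [j jJ phij] JQ t tP.
have phi0 : phi 0 = 0 by have := phiM 0 (rpred0 (ideal_mem P)); rewrite !mul0r.
have [||| C CE] := @ideal_of_set R
  [set u + phi v | u in ideal_set J & v in ideal_set J].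
- exists 0; first exact/ideal_memP/rpred0.
  by exists 0; [exact/ideal_memP/rpred0|rewrite phi0 addr0].
- move=> _ _ [u1 /ideal_memP Ju1 [v1 /ideal_memP Jv1 <-]]
    [u2 /ideal_memP Ju2 [v2 /ideal_memP Jv2 <-]].
  exists (u1 - u2); first exact/ideal_memP/rpredB.
  exists (v1 - v2); first exact/ideal_memP/rpredB.
  by rewrite dualB ?JP //; ring.
- move=> a _ [u /ideal_memP Ju [v /ideal_memP Jv <-]].
  exists (a * u); first exact/ideal_memP/ideal_mull.
  exists (a * v); first exact/ideal_memP/ideal_mull.
  by rewrite phiM ?JP // mulrDr.
have JC : {subset ideal_mem J <= ideal_mem C}.
  move=> a /ideal_memP Ja; apply/ideal_memP; rewrite CE; exists a => //.
  by exists 0; [exact/ideal_memP/rpred0|rewrite phi0 addr0].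
case: (boolP (1 \in ideal_mem C)) => [/ideal_memP|C1].
  rewrite CE => -[u /ideal_memP Ju [v /ideal_memP Jv uv1]].
  rewrite -[t]mulr1 -uv1 mulrDr (dualMC tP (JP _ Jv)).
  by apply: rpredD; apply: ideal_mull.
have [Q [Q_prime CQ]] := exists_prime_above (finite_index_sub JC J_fin) C1.
have QP : Q = P by apply: JQ => // a /JC/CQ.
case/negP: phij; rewrite -QP; apply/CQ/ideal_memP; rewrite CE.
by exists 0; [exact/ideal_memP/rpred0|exists j; [apply/ideal_memP|rewrite add0r]].
Qed.

End Dual.

(** * A conductor criterion for a subring to be everything *)

Section Conductor.
Variables (R : comNzRingType) (I : ideal R) (S : set R).
Hypothesis I_fin : finite_index I.
Hypotheses (S1 : S 1) (SB : forall a b, S a -> S b -> S (a - b)).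
Hypothesis SM : forall a b, S a -> S b -> S (a * b).
Hypothesis IS : forall a, a \in ideal_mem I -> S a.

Let module (B : set R) := (forall a b, B a -> B b -> B (a - b)) /\
  (forall s a, S s -> B a -> B (s * a)).

Lemma subring_eq_whole :
    (forall P, prime_ideal P -> {subset ideal_mem I <= ideal_mem P} ->
      [/\ forall a, exists2 s, S s & a - s \in ideal_mem P,
          exists phi s, [/\ is_dual P phi, S s, s \in ideal_mem P
             & phi s \notin ideal_mem P] &
          forall Q, prime_ideal Q -> {subset ideal_mem I <= ideal_mem Q} ->
            (forall s, S s -> s \in ideal_mem P -> s \in ideal_mem Q) -> Q = P]) ->
  forall a, S a.
Proof.
move=> local a; apply: contrapT => Sa.
pose Phi (B : set R) := [/\ module B, S `<=` B & exists c, ~ B c].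
have sat B b c : Phi B -> c - b \in ideal_mem I -> B b -> B c.
  move=> [[BB BM] SsubB _] /IS/SsubB cb Bb.
  have B0 : B 0 by rewrite -(subrr b); apply: BB.
  have B_N : B (- b) by rewrite -sub0r; apply: BB.
  by have := BB _ _ cb B_N; rewrite opprK subrK.
have [|B [[[BB BM] SsubB [c0 Bc0]] _ Bmax]] := exists_maximal_set I_fin sat (B0 := S).
  by split=> //; exists a.
have S0 : S 0 by rewrite -(subrr 1); apply: SB.
have B0 : B 0 by apply: SsubB.
have BD u v : B u -> B v -> B (u + v).
  by move=> Bu Bv; rewrite -[v]opprK; apply: (BB) => //; rewrite -sub0r; apply: BB.
have SX s n : S s -> S (s ^+ n).
  by move=> Ss; elim: n => [|n IHn]; rewrite ?expr0 // exprS; apply: SM.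
(* The conductor of [B] is the largest ideal of the ring contained in [B]. *)
have [||| J JE] := @ideal_of_set R [set z | forall c, B (z * c)].
- by move=> c; rewrite mul0r.
- by move=> u v Ju Jv c; rewrite mulrBl; apply: BB.
- by move=> u v Jv c; rewrite -mulrA mulrCA.
have JP z : z \in ideal_mem J <-> forall c, B (z * c).
  by split=> [/ideal_memP|Bz]; [rewrite JE | apply/ideal_memP; rewrite JE].
have IJ : {subset ideal_mem I <= ideal_mem J}.
  by move=> z zI; apply/JP => c; apply/SsubB/IS/ideal_mulr.
have J_fin := finite_index_sub IJ I_fin.
have J1 : 1 \notin ideal_mem J.
  by apply/negP => /JP/(_ c0); rewrite mul1r.
have [P [P_prime JsubP]] := exists_prime_above J_fin J1.
have [SP [phi [s0 [phi_dual Ss0 s0P phis0]]] PQ] :=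
  local P P_prime (fun z zI => JsubP z (IJ z zI)).
(* [J] is prime on [S]. The submodule [C = s R + B] is everything, since otherwise maximality gives
   [s R <= B], that is [s] in [J]; and [t C <= B], because [s t] is in [J]. *)
have J_prime s t : S s -> S t -> s * t \in ideal_mem J -> s \notin ideal_mem J ->
    t \in ideal_mem J.
  move=> Ss St stJ sJ; apply/JP => c.
  pose C := [set s * u + v | u in [set: R] & v in B].
  have BC : B `<=` C by move=> v Bv; exists 0 => //; exists v => //; rewrite mulr0 add0r.
  have [|Cc] := pselect (C c).
    case=> u _ [v Bv <-]; rewrite mulrDr mulrCA mulrA.
    by apply: BD; [apply: (JP _).1 | apply: BM].
  have /Bmax/(_ BC) CB : Phi C.
    split; last by exists c.
      split=> [_ _ [u1 _ [v1 Bv1 <-]] [u2 _ [v2 Bv2 <-]]|r _ Sr [u _ [v Bv <-]]].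
        by exists (u1 - u2) => //; exists (v1 - v2); [apply: BB|ring].
      by exists (r * u) => //; exists (r * v); [apply: BM|ring].
    by move=> z /SsubB/BC.
  case/negP: sJ; apply/JP => u; apply: CB.
  by exists u => //; exists 0; rewrite // addr0.
(* Two powers of [s] agree modulo [J]. If [s] were not in [J], cancelling it would put some
   [1 - s ^+ k * s] in [J], hence 1 in [P]. *)
have SPJ s : S s -> s \in ideal_mem P -> s \in ideal_mem J.
  move=> Ss sP; apply: contraT => sJ.
  have [i [j [ij]]] := finite_index_pigeonhole (GRing.exp s) J_fin.
  rewrite -(subnK ij) addnS exprS exprD; move: (j - i.+1)%N => k.
  have -> : s ^+ i - s * (s ^+ k * s ^+ i) = s ^+ i * (1 - s ^+ k * s) by ring.
  have Sk : S (1 - s ^+ k * s) by apply: SB => //; apply: SM => //; apply: SX.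
  have kJ : 1 - s ^+ k * s \notin ideal_mem J.
    apply: contraNN (prime_ideal1 P_prime) => /JsubP kP.
    by rewrite -[1](subrK (s ^+ k * s)) rpredD // ideal_mull.
  elim: i {ij} => [|i IHi]; first by rewrite expr0 mul1r (negPf kJ).
  rewrite exprS -mulrA => sJi; apply: IHi; apply: J_prime sJi sJ => //.
  by apply: SM => //; apply: SX.
have PJ : {subset ideal_mem P <= ideal_mem J}.
  apply: (invertible_eq phi_dual) => //; first by exists s0 => //; apply: SPJ.
  move=> Q Q_prime JQ; apply: PQ => // [z /IJ/JQ //|s Ss sP].
  exact/JQ/SPJ.
have [s Ss /PJ/JP/(_ 1)] := SP c0; rewrite mulr1 => Bcs.
by apply: Bc0; rewrite -[c0](subrK s); apply: BD => //; apply: SsubB.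
Qed.

End Conductor.

(** For [b] in [P] the last term lies in the square of [P], so the derivative alone governs the
    change there. *)
Lemma int_eval_taylor (R : comNzRingType) (a b : R) g : exists c,
  int_eval (a + b) g = int_eval a g + int_eval a g^`() * b + c * b ^+ 2.
Proof.
elim/poly_ind: g => [|g k [c IHg]].
  by exists 0; rewrite deriv0 !rmorph0 !mul0r !addr0.
exists (int_eval a g^`() + c * (a + b)).
rewrite derivMXaddC !rmorphD !rmorphM /= !int_evalX !int_evalC IHg; ring.
Qed.

Lemma int_eval_congr (R : comNzRingType) (a b : R) g : exists c,
  int_eval a g = int_eval b g + c * (a - b).
Proof.
have [c] := int_eval_taylor b (a - b) g; rewrite [b + _]addrC subrK => ->.
by exists (int_eval b g^`() + c * (a - b)); ring.
Qed.

(* For invertible P this says that x lies in the square of P. *)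
Definition in_square (R : comNzRingType) (P : ideal R) (x : R) : Prop :=
  x \in ideal_mem P /\ forall phi, is_dual P phi -> phi x \in ideal_mem P.

Section InSquare.
Variables (R : comNzRingType) (P : ideal R).

Lemma in_squareD x y : in_square P x -> in_square P y -> in_square P (x + y).
Proof.
move=> [xP xphi] [yP yphi]; split=> [|phi dphi]; first exact: rpredD.
by case: (dphi) => phiD _ _; rewrite phiD //; apply: rpredD; [apply: xphi|apply: yphi].
Qed.

Lemma in_squareMl a x : in_square P x -> in_square P (a * x).
Proof.
move=> [xP xphi]; split=> [|phi dphi]; first exact: ideal_mull.
by case: (dphi) => _ phiM _; rewrite phiM //; apply/ideal_mull/xphi.
Qed.

Lemma in_squareM x y : x \in ideal_mem P -> y \in ideal_mem P -> in_square P (x * y).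
Proof.
move=> xP yP; split=> [|phi dphi]; first exact: ideal_mull.
by case: (dphi) => _ phiM _; rewrite phiM //; apply/ideal_mulr.
Qed.
End InSquare.

(** * Chinese remainders modulo squares of primes *)

Section ChineseRemainder.
Variable R : comNzRingType.
Implicit Types (P Q : ideal R) (Ps : seq (ideal R)).

Definition prime_fin P := prime_ideal P /\ finite_index P.

Lemma prime_fin_sub_eq P Q : prime_fin P -> prime_fin Q ->
  {subset ideal_mem P <= ideal_mem Q} -> P = Q.
Proof.
move=> [Pp Pf] [Qp Qf] PQ; apply: ideal_eq => a; apply/idP/idP => [/PQ//|aQ].
apply: contraT => /(prime_ideal_max Pp Pf)[b /PQ ba].
by case/negP: (prime_ideal1 Qp); rewrite -[1](subrK (b * a)) rpredD // ideal_mull.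
Qed.

(** Primes of finite index are maximal, so each [Q] has an element outside [P]; a multiple of it is
    1 modulo [P], and [w] is the product of these multiples. *)
Lemma separating_element P Ps : prime_fin P -> {in Ps, forall Q, prime_fin Q} ->
  P \notin Ps -> exists w, 1 - w \in ideal_mem P /\ {in Ps, forall Q, w \in ideal_mem Q}.
Proof.
move=> Pp; elim: Ps => [|Q Ps IHPs] Psp; first by exists 1; rewrite subrr rpred0.
rewrite inE negb_or => /andP[PQ PPs].
have [|w [wP wPs]] := IHPs _ PPs.
  by move=> T TPs; apply: Psp; rewrite inE TPs orbT.
have [t tQ tP] : exists2 t, t \in ideal_mem Q & t \notin ideal_mem P.
  apply: contrapT => nt; case/eqP: PQ; apply/esym; apply: prime_fin_sub_eq => //.
    by apply: Psp; rewrite inE eqxx.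
  by move=> t tQ; apply: contraT => tP; case: nt; exists t.
have [b bt] := prime_ideal_max Pp.1 Pp.2 tP.
exists (w * (b * t)); split.
  have -> : 1 - w * (b * t) = (1 - w) + w * (1 - b * t) by ring.
  by apply: rpredD => //; apply: ideal_mull.
move=> T; rewrite inE => /orP[/eqP->|/wPs wT]; last exact: ideal_mulr.
by do 2 apply: ideal_mull.
Qed.

Lemma chinese_remainder_square Ps (y : ideal R -> R) :
  uniq Ps -> {in Ps, forall P, prime_fin P} ->
  exists x, {in Ps, forall P, in_square P (x - y P)}.
Proof.
elim: Ps => [|P Ps IHPs] /=; first by exists 0.
move=> /andP[PPs Ps_uniq] Psp.
have Psp' : {in Ps, forall Q, prime_fin Q}.
  by move=> T TPs; apply: Psp; rewrite inE TPs orbT.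
have Pp : prime_fin P by apply: Psp; rewrite inE eqxx.
have [x xPs] := IHPs Ps_uniq Psp'.
have [w [wP wPs]] := separating_element Pp Psp' PPs.
(* The weight [w^2 (2 - w^2) = 1 - (1 - w^2)^2] is 0 modulo the square of each [Q] in [Ps] and 1
   modulo the square of [P]. *)
exists (x + (y P - x) * (w * w * (2%:R - w * w))) => Q.
rewrite inE => /orP[/eqP->|QPs].
  set z := (X in in_square _ X).
  have -> : z = (x - y P) * (1 + w) ^+ 2 * ((1 - w) * (1 - w)) by rewrite /z; ring.
  exact/in_squareMl/in_squareM.
set z := (X in in_square _ X).
have -> : z = (x - y Q) + (y P - x) * (2%:R - w * w) * (w * w) by rewrite /z; ring.
by apply: in_squareD; [apply: xPs|apply: in_squareMl; apply: in_squareM; apply: wPs].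
Qed.

End ChineseRemainder.

(** * Roots modulo one prime ideal *)

Section LocalGenerator.
Variables (R : comNzRingType) (P : ideal R) (p f : nat).
Hypotheses (P_prime : prime_ideal P) (P_fin : finite_index P).
Hypotheses (p_pr : prime p) (Pp : lies_over P p).
Hypothesis Pf : has_residual_degree P p f.
Variables (q : {poly_(f.+1) 'F_p}) (g : {poly int}).
Hypotheses (q_elig : q \in eligible p f) (gq : map_poly intr g = q :> {poly 'F_p}).

Let q_size : size q = f.+1.
Proof. by move: q_elig; rewrite inE => /and4P[/eqP]. Qed.

Let q_monic : (q : {poly 'F_p}) \is monic.
Proof. by move: q_elig; rewrite inE => /and4P[]. Qed.

Let q_irr : irreducible_poly (q : {poly 'F_p}).
Proof. by move: q_elig; rewrite inE => /and4P[_ _ /irreducibleP]. Qed.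

Let q_neqX : (q : {poly 'F_p}) != 'X.
Proof. by move: q_elig; rewrite inE => /and4P[]. Qed.

Let field_data : exists (F : finFieldType) (psi : {rmorphism R -> F})
    (iota : {rmorphism 'F_p -> F}),
  [/\ forall y, exists a, psi a = y,
      forall a, (psi a == 0) = (a \in ideal_mem P) &
      #|F| = (#|'F_p| ^ (size q).-1)%N].
Proof.
have [F [psi [psi_surj psi_ker]]] := residue_fieldP P_prime P_fin.
have p_char : p \in [pchar F] by apply/(lies_overP psi_ker).
exists F, psi, (Fp_morphism p_char); split=> //.
rewrite card_Fp // q_size.
exact: (has_residual_degreeP psi_surj psi_ker f p_pr p_char).1.
Qed.

(** Lift a root of [q] to [a]. If [g(a)] is in the square of [P], move to [a + b] with [phi b] equal
    to 1 modulo [P]: this adds [g'(a) phi(b)] to [phi (g(a))] modulo [P], and [g'(a)] is not in [P]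
    because the root is simple. *)
Lemma exists_local_generator phi : is_dual P phi ->
  exists x, int_eval x g \in ideal_mem P /\ phi (int_eval x g) \notin ideal_mem P.
Proof.
move=> phi_dual; have [F [psi [iota [psi_surj psi_ker cF]]]] := field_data.
have [y qy] := irreducible_has_root iota q_monic q_irr cF.
have [a ay] := psi_surj y; rewrite -{y}ay in qy.
have gaP : int_eval a g \in ideal_mem P.
  by rewrite -psi_ker (residue_int_eval iota) gq.
have g'aP : int_eval a g^`() \notin ideal_mem P.
  rewrite -psi_ker (residue_int_eval iota) -deriv_map gq.
  exact: irreducible_root_deriv q_monic q_irr qy.
have [phiga|] := boolP (phi (int_eval a g) \in ideal_mem P); last by exists a.
case: (phi_dual) => phiD phiM [b bP phib].
have [c gab] := int_eval_taylor a b g; exists (a + b).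
have g'bP : int_eval a g^`() * b \in ideal_mem P by apply: ideal_mull.
have cbP : c * b ^+ 2 \in ideal_mem P by rewrite expr2; do 2 apply: ideal_mull.
rewrite gab; split; first by rewrite !rpredD.
have -> : phi (int_eval a g + int_eval a g^`() * b + c * b ^+ 2) =
    phi (int_eval a g) + int_eval a g^`() * phi b + b * (c * phi b).
  rewrite (phiD _ _ (rpredD gaP g'bP) cbP) (phiD _ _ gaP g'bP) (phiM _ _ bP).
  by rewrite expr2 mulrA (phiM _ _ bP); ring.
rewrite rpredDr; last exact: ideal_mulr.
rewrite rpredDl // prime_idealM // (negPf g'aP) /=.
apply: contraNN (prime_ideal1 P_prime) => phibP.
by rewrite -[1](subrK (phi b)) rpredD.
Qed.

Variable x : R.
Hypothesis gx : int_eval x g \in ideal_mem P.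

Lemma local_root_generates a : exists h, a - int_eval x h \in ideal_mem P.
Proof.
have [F [psi [iota [psi_surj psi_ker cF]]]] := field_data.
have qx : root (map_poly iota (q : {poly 'F_p})) (psi x).
  by rewrite -gq rootE -residue_int_eval psi_ker.
have [h hE] := root_generates q_irr qx cF (psi a).
have [k kh] := reduction_surj h; exists k.
by rewrite -psi_ker rmorphB subr_eq0 (residue_int_eval iota) kh hE.
Qed.

Lemma local_root_dvdp h :
  int_eval x h \in ideal_mem P -> (q : {poly 'F_p}) %| map_poly intr h.
Proof.
have [F [psi [iota [psi_surj psi_ker cF]]]] := field_data.
have qx : root (map_poly iota (q : {poly 'F_p})) (psi x).
  by rewrite -gq rootE -residue_int_eval psi_ker.
by rewrite -psi_ker (residue_int_eval iota) -(root_irreducible _ q_irr qx).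
Qed.

(** Otherwise [q] would divide ['X], hence equal it. *)
Lemma local_root_notin : x \notin ideal_mem P.
Proof.
apply: contra q_neqX => xP; rewrite -eqp_monic ?monicX //.
have := @local_root_dvdp 'X; rewrite int_evalX map_polyX => /(_ xP) qX.
have [_] := irredp_XsubC (0 : 'F_p); rewrite subr0; apply=> //.
by have [q1 _] := q_irr; rewrite neq_ltn q1 orbT.
Qed.

End LocalGenerator.

(** * From local roots to a global generator *)

Section Generator.
Variables (R : comNzRingType) (I : ideal R).
Hypothesis I_fin : finite_index I.
Implicit Types P Q : ideal R.

(** An ideal above [I] is determined by the representatives in [L] that it contains. *)
Lemma finite_overideals : finite_set [set P | {subset ideal_mem I <= ideal_mem P}].
Proof.
have [L HL] := I_fin.
pose code P : {ffun 'I_(size L) -> bool} :=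
    [ffun i : 'I_(size L) => nth 0 L i \in ideal_mem P].
pose decode c := xget I [set P | {subset ideal_mem I <= ideal_mem P} /\ code P = c].
apply: (sub_finite_set _ (finite_image decode (@finite_finset _ setT))).
move=> P /= IP; exists (code P) => //; rewrite /decode.
case: xgetP => [Q _ [IQ cQ]|/(_ P)]; last by case.
apply: ideal_eq => a; have [l lL al] := HL a.
rewrite -[a](subrK l) (rpredDl _ (IQ _ al)) (rpredDl _ (IP _ al)).
have il : (index l L < size L)%N by rewrite index_mem.
by have /ffunP/(_ (Ordinal il)) := cQ; rewrite !ffunE /= nth_index.
Qed.

Lemma exists_local_data P : prime_ideal P -> finite_index P ->
  exists pf : nat * nat, [/\ prime pf.1, (0 < pf.2)%N, lies_over P pf.1 &
    has_residual_degree P pf.1 pf.2].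
Proof.
move=> P_prime P_fin.
have [F [psi [psi_surj psi_ker]]] := residue_fieldP P_prime P_fin.
have [p p_pr p_char] := finPcharP F; have cF := card_pprimeChar p_char.
exists (p, logn p #|F|); split=> //=.
- by rewrite lt0n; apply/eqP => e; have := finNzRing_gt1 F; rewrite cF e.
- exact/(lies_overP psi_ker).
- exact/(has_residual_degreeP psi_surj psi_ker).
Qed.

Definition divisors_over p f : set (ideal R) := [set P | [/\ prime_ideal P,
  lies_over P p, ideal_divides P I & has_residual_degree P p f]].

Lemma exists_eligible_choice p f : prime p -> (0 < f)%N ->
    (num_prime_divisors I p f < tau p f)%N ->
  exists g : ideal R -> {poly int},
    (forall P, divisors_over p f P -> exists2 q : {poly_(f.+1) 'F_p},
       q \in eligible p f & map_poly intr (g P) = q :> {poly 'F_p}) /\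
    forall P Q, divisors_over p f P -> divisors_over p f Q ->
      map_poly intr (g P) = map_poly intr (g Q) :> {poly 'F_p} -> P = Q.
Proof.
move=> p_pr f0; rewrite -card_eligible // ltnS /num_prime_divisors cardE.
set D := fset_set _ => card_D.
have memD P : divisors_over p f P -> P \in D.
  move=> DP; rewrite in_fset_set; first exact/mem_set.
  by apply: sub_finite_set finite_overideals => Q [_ _ /ideal_divides_sub].
(* The prime in position [n] receives the eligible polynomial in position [n]; [card_D] says that
   there are enough of them. *)
pose q P : {poly_(f.+1) 'F_p} := nth 0 (enum (eligible p f)) (index P D).
have q_elig P : divisors_over p f P -> q P \in eligible p f.
  move=> /memD PD; rewrite -mem_enum mem_nth //.
  by apply: leq_trans card_D; rewrite index_mem.
have [g gq] := choice (fun P => reduction_surj (q P : {poly 'F_p})).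
exists g; split=> [P DP|P Q DP DQ]; first by exists (q P); [apply: q_elig|].
rewrite !gq => /val_inj /eqP; rewrite nth_uniq ?enum_uniq //.
- move=> /eqP PQ; rewrite -(nth_index I (memD _ DP)) PQ nth_index //.
  exact: memD.
- by apply: leq_trans card_D; rewrite index_mem memD.
- by apply: leq_trans card_D; rewrite index_mem memD.
Qed.

(** The polynomials are chosen separately for each pair [(p, f)]. Primes over the same [p] with
    different [f] get polynomials of different degrees, so injectivity holds over each [p]. *)
Lemma exists_polynomial_choice : ~ faulty I ->
    (forall P, prime_ideal P -> {subset ideal_mem I <= ideal_mem P} ->
       invertible P) ->
  exists (pf : ideal R -> nat * nat) (g : ideal R -> {poly int}),
    (forall P, prime_ideal P -> {subset ideal_mem I <= ideal_mem P} ->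
      [/\ prime (pf P).1, lies_over P (pf P).1,
          has_residual_degree P (pf P).1 (pf P).2 &
          exists2 q : {poly_((pf P).2.+1) 'F_((pf P).1)},
            q \in eligible (pf P).1 (pf P).2 &
            map_poly intr (g P) = q :> {poly 'F_((pf P).1)}]) /\
    forall P Q, prime_ideal P -> {subset ideal_mem I <= ideal_mem P} ->
      prime_ideal Q -> {subset ideal_mem I <= ideal_mem Q} ->
      (pf P).1 = (pf Q).1 ->
      map_poly intr (g P) = map_poly intr (g Q) :> {poly 'F_((pf Q).1)} -> P = Q.
Proof.
move=> nfaulty inv.
have wit (P : ideal R) : exists pf : nat * nat, prime_ideal P ->
    {subset ideal_mem I <= ideal_mem P} -> [/\ prime pf.1, (0 < pf.2)%N &
    divisors_over pf.1 pf.2 P].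
  case: (pselect (prime_ideal P)) => P_prime; last by exists (0, 0)%N.
  case: (pselect {subset ideal_mem I <= ideal_mem P}) => IP; last by exists (0, 0)%N.
  have [pf [? ? ? ?]] := exists_local_data P_prime (finite_index_sub IP I_fin).
  exists pf => _ _; split=> //; split=> //.
  by have [phi phi_dual] := inv P P_prime IP; exact: (invertible_divides phi_dual IP).
have [pf pfP] := choice wit.
have wit2 (a : nat * nat) : exists g : ideal R -> {poly int},
    prime a.1 -> (0 < a.2)%N ->
    (forall P, divisors_over a.1 a.2 P -> exists2 q : {poly_(a.2.+1) 'F_a.1},
       q \in eligible a.1 a.2 & map_poly intr (g P) = q :> {poly 'F_a.1}) /\
    forall P Q, divisors_over a.1 a.2 P -> divisors_over a.1 a.2 Q ->
      map_poly intr (g P) = map_poly intr (g Q) :> {poly 'F_a.1} -> P = Q.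
  case: (pselect (prime a.1 /\ (0 < a.2)%N)) => [[a1 a2]|na]; last first.
    by exists (fun=> 0) => a1 a2; case: na.
  have [|g ?] := exists_eligible_choice a1 a2; last by exists g.
  by rewrite ltnNge; apply/negP => le; apply: nfaulty; exists a.1, a.2.
have [g gP] := choice wit2; exists pf, (fun P => g (pf P) P).
split=> [P P_prime IP|P Q P_prime IP Q_prime IQ].
  have [p_pr f0 DP] := pfP P P_prime IP; have [_ Pp _ Pf] := DP.
  by split=> //; apply: (gP _ p_pr f0).1.
have [p_pr f0 DP] := pfP P P_prime IP.
have [p'_pr f'0 DQ] := pfP Q Q_prime IQ.
have [qP qP_elig qPE] := (gP _ p_pr f0).1 P DP.
have [qQ qQ_elig qQE] := (gP _ p'_pr f'0).1 Q DQ.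
have := (gP _ p'_pr f'0).2 P Q.
(* The types of these polynomials depend on [pf P] and [pf Q], so everything is generalised before
   the two characteristics are identified. *)
move: DP qP qP_elig qPE DQ qQ qQ_elig qQE.
case: (pf P) (pf Q) => [p f] [p' f'] /= DP qP qP_elig qPE DQ qQ qQ_elig qQE.
move=> inj pp'; move: DP qP qP_elig qPE; rewrite {p}pp' => DP qP qP_elig qPE eqPQ.
have ff' : f = f'.
  move: qP_elig qQ_elig; rewrite !inE => /and4P[/eqP sP _ _ _] /and4P[/eqP sQ _ _ _].
  by apply: succn_inj; rewrite -sP -sQ -qPE -qQE eqPQ.
by subst f'; apply: inj.
Qed.

Lemma exists_generator : ~ faulty I ->
    (forall P, prime_ideal P -> {subset ideal_mem I <= ideal_mem P} ->
       invertible P) ->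
  exists x, generates I x.
Proof.
move=> nfaulty inv.
have [pf [g [gP g_inj]]] := exists_polynomial_choice nfaulty inv.
pose over P := prime_ideal P /\ {subset ideal_mem I <= ideal_mem P}.
have over_fin : finite_set [set P | over P].
  by apply: sub_finite_set finite_overideals => P [].
pose Ps := fset_set [set P | over P] : seq (ideal R).
have memPs P : P \in Ps <-> over P.
  by rewrite in_fset_set //; split=> [/set_mem|/mem_set].
have Ps_fin : {in Ps, forall P, prime_fin P}.
  by move=> P /memPs[P_prime IP]; split=> //; apply: finite_index_sub IP I_fin.
have wit (P : ideal R) : exists y, over P -> exists phi, [/\ is_dual P phi,
    int_eval y (g P) \in ideal_mem P & phi (int_eval y (g P)) \notin ideal_mem P].
  case: (pselect (over P)) => [[P_prime IP]|]; last by exists 0.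
  have [phi phi_dual] := inv P P_prime IP.
  have [p_pr Pp Pf [q q_elig gq]] := gP P P_prime IP.
  have [y [? ?]] := exists_local_generator P_prime (finite_index_sub IP I_fin)
    p_pr Pp Pf q_elig gq phi_dual.
  by exists y => _; exists phi.
have [y yP] := choice wit.
have [x xy] := chinese_remainder_square y (fset_uniq _ : uniq Ps) Ps_fin.
have xP P : over P -> exists phi, [/\ is_dual P phi,
    int_eval x (g P) \in ideal_mem P & phi (int_eval x (g P)) \notin ideal_mem P].
  move=> oP; have [phi [phi_dual gyP phigy]] := yP P oP; exists phi.
  (* [g P] takes values at [x] and [y P] that differ by a multiple of [x - y P], hence by an element
     of the square of [P]; both conclusions carry over. *)
  have [c ->] := int_eval_congr x (y P) (g P).
  have [dP dphi] := in_squareMl c (xy P ((memPs P).2 oP)).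
  case: (phi_dual) => phiD _ _; split=> //; first exact: rpredD.
  by rewrite phiD // (rpredDr _ (dphi _ phi_dual)).
pose S : set R := [set a | exists h, a - int_eval x h \in ideal_mem I].
have S_all : forall a, S a.
  apply: (subring_eq_whole I_fin).
  - by exists 1; rewrite rmorph1 subrr rpred0.
  - move=> a b [h ha] [k kb]; exists (h - k).
    have -> : a - b - int_eval x (h - k) = (a - int_eval x h) - (b - int_eval x k).
      by rewrite rmorphB; ring.
    exact: rpredB.
  - move=> a b [h ha] [k kb]; exists (h * k).
    have -> : a * b - int_eval x (h * k) =
        b * (a - int_eval x h) + int_eval x h * (b - int_eval x k).
      by rewrite rmorphM; ring.
    by apply: rpredD; apply: ideal_mull.
  - by move=> a aI; exists 0; rewrite rmorph0 subr0.
  have S_eval h : S (int_eval x h) by exists h; rewrite subrr rpred0.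
  move=> P P_prime IP; have [p_pr Pp Pf [q q_elig gq]] := gP P P_prime IP.
  have P_fin := finite_index_sub IP I_fin.
  have [phi [phi_dual gxP phigx]] := xP P (conj P_prime IP).
  split=> [a||Q Q_prime IQ SPQ].
  - have [h hP] := local_root_generates P_prime P_fin p_pr Pp Pf q_elig gq gxP a.
    by exists (int_eval x h).
  - by exists phi, (int_eval x (g P)).
  have [p'_pr Qp' Qf [q' q'_elig gq']] := gP Q Q_prime IQ.
  have Q_fin := finite_index_sub IQ I_fin.
  have [phi' [phi'_dual gxQ _]] := xP Q (conj Q_prime IQ).
  (* The characteristic of the residue field of [P] is an integer, so it lies in [S] and in [P], and
     therefore in [Q]. *)
  have pp' : (pf P).1 = (pf Q).1.
    have pP : (pf P).1%:R \in ideal_mem P.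
      by have := Pp (pf P).1; rewrite -pmulrn dvdzz.
    have : (pf P).1%:R \in ideal_mem Q.
      apply: SPQ => //; exists ((pf P).1%:R)%:P.
      by rewrite int_evalC rmorph_nat subrr rpred0.
    have := Qp' (pf P).1; rewrite -pmulrn -ideal_memE => ->.
    by rewrite dvdzE /= dvdn_prime2 // => /eqP.
  apply/esym; apply: g_inj => //.
  (* The value of [g P] at [x] is in [S] and in [P], hence in [Q], so the polynomial of [Q] divides
     that of [P]. Both are monic and irreducible, hence equal. *)
  have := local_root_dvdp Q_prime Q_fin p'_pr Qp' Qf q'_elig gq' gxQ
    (SPQ _ (S_eval _) gxP).
  move: {gP} q q_elig gq; rewrite pp' => q q_elig gq; rewrite gq gq'.
  move: q_elig q'_elig; rewrite !inE => /and4P[_ q_mon /irreducibleP q_irr _].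
  move=> /and4P[_ q'_mon /irreducibleP q'_irr _] q'q; apply/eqP.
  rewrite -eqp_monic // eqp_sym; have [_] := q_irr; apply=> //.
  by have [q1 _] := q'_irr; rewrite neq_ltn q1 orbT.
(* It remains to remove the constant terms. The ideal [x R + I] is everything, since [x] lies in no
   prime above [I]; from [1 = x r + i] one gets [b = x (b r)] modulo [I], and [b r] is a polynomial
   in [x] modulo [I]. *)
exists x => b.
have [||| J JE] := @ideal_of_set R [set x * r + i | r in [set: R] & i in ideal_set I].
- by exists 0 => //; exists 0; [exact/ideal_memP/rpred0|rewrite mulr0 addr0].
- move=> _ _ [r1 _ [i1 /ideal_memP Ii1 <-]] [r2 _ [i2 /ideal_memP Ii2 <-]].
  by exists (r1 - r2) => //; exists (i1 - i2); [exact/ideal_memP/rpredB|ring].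
- move=> a _ [r _ [i /ideal_memP Ii <-]].
  by exists (a * r) => //; exists (a * i); [exact/ideal_memP/ideal_mull|ring].
have IJ : {subset ideal_mem I <= ideal_mem J}.
  move=> i /ideal_memP Ii; apply/ideal_memP; rewrite JE.
  by exists 0 => //; exists i; rewrite // mulr0 add0r.
have [/ideal_memP|J1] := boolP (1 \in ideal_mem J).
  rewrite JE => -[r _ [i /ideal_memP Ii xri]].
  have [h hbr] := S_all (b * r); exists h.
  have -> : b - x * int_eval x h = b * (1 - x * r) + x * (b * r - int_eval x h) by ring.
  by apply: rpredD; apply: ideal_mull; rewrite // -xri addrC addKr.
have [P [P_prime JP]] := exists_prime_above (finite_index_sub IJ I_fin) J1.
have IP : {subset ideal_mem I <= ideal_mem P} by move=> i /IJ/JP.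
have [p_pr Pp Pf [q q_elig gq]] := gP P P_prime IP.
have [phi [_ gxP _]] := xP P (conj P_prime IP).
have := local_root_notin P_prime (finite_index_sub IP I_fin) p_pr Pp Pf q_elig gq gxP.
case/negP; apply/JP/ideal_memP; rewrite JE.
by exists 1 => //; exists 0; [exact/ideal_memP/rpred0|rewrite mulr1 addr0].
Qed.

Lemma coverable_iff_faulty :
    (forall P, prime_ideal P -> {subset ideal_mem I <= ideal_mem P} ->
       invertible P) ->
  coverable (quotient I) <-> faulty I.
Proof.
move=> inv; rewrite coverableP; split=> [ngen|].
  by apply: contrapT => nfaulty; apply: ngen; apply: exists_generator.
exact: faulty_not_generated.
Qed.

End Generator.

(** * Rings of integers *)

Import Order.TTheory Num.Theory.

Lemma common_denominator m (r : 'I_m -> rat) : exists (D : int) (c : 'I_m -> int),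
  D != 0 /\ forall i, (c i)%:~R = D%:~R * r i.
Proof.
exists (\prod_j denq (r j)), (fun i => numq (r i) * \prod_(j | j != i) denq (r j)).
split=> [|i]; first by apply/prodf_neq0 => j _; apply: denq_neq0.
by rewrite [in RHS](bigD1 i) //= !intrM numqE; ring.
Qed.

Section IntegerRelations.
Variable K : fieldExtType rat.

Lemma integer_relation m (x : 'I_m -> K) : (\dim {:K} < m)%N ->
  exists c : 'I_m -> int, (exists i, c i != 0) /\ \sum_i (c i)%:~R * x i = 0.
Proof.
move=> dim_m; pose X := [tuple x i | i < m].
have [k [k_rel [i ki]]] : exists k : 'I_m -> rat,
    \sum_i k i *: X`_i = 0 /\ exists i, k i != 0.
  apply: contrapT => nk; have /eqP : free X.
    apply/freeP => k k_rel i; apply: contrapT => ki; case: nk; exists k; split=> //.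
    by exists i; apply/eqP.
  move=> dimX; have := dimvS (subvf <<X>>%VS).
  by rewrite dimX size_tuple leqNgt dim_m.
have [D [c [D0 cE]]] := common_denominator k.
exists c; split.
  by exists i; rewrite -(intr_eq0 rat) cE mulf_neq0 // intr_eq0.
have -> : \sum_i (c i)%:~R * x i = D%:~R * \sum_i k i *: X`_i.
  rewrite mulr_sumr; apply: eq_bigr => j _.
  rewrite -[X in X * _]scaler_int cE -scalerAl mul1r -scalerA scaler_int.
  by rewrite -mulrzl -tnth_nth tnth_mktuple.
by rewrite k_rel mulr0.
Qed.

(** An integer relation is divided by the gcd [G] of its coefficients; if [p] still divided them
    all, [p * G] would divide [G]. *)
Lemma primitive_relation (p m : nat) (x : 'I_m -> K) : prime p -> (\dim {:K} < m)%N ->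
  exists c : 'I_m -> int, (exists i, ~~ (p %| c i)%Z) /\ \sum_i (c i)%:~R * x i = 0.
Proof.
move=> p_pr /integer_relation-/(_ x)[c [[i0 ci0] c_rel]].
pose G := \big[gcdn/0%N]_i `|c i|%N.
have Gc i : (G%:Z %| c i)%Z by rewrite dvdzE /=; apply: (biggcdn_inf i).
have G0 : (0 < G)%N.
  rewrite lt0n; apply: contraNneq ci0 => G0; have := Gc i0.
  by rewrite G0 dvd0z.
exists (fun i => c i %/ G)%Z; split.
  apply: contrapT => all_dvd; have : (p * G %| G)%N.
    apply/dvdn_biggcdP => i _; rewrite -(divzK (Gc i)) abszM dvdn_mul //.
    by apply: contrapT => ndvd; case: all_dvd; exists i; rewrite dvdzE; apply/negP.
  by move/(dvdn_leq G0); rewrite leqNgt ltn_Pmull ?prime_gt1.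
have GK : (G%:Z)%:~R != 0 :> K.
  by rewrite -(rmorph_int (in_alg K)) fmorph_eq0 intr_eq0 -lt0n.
apply: (mulfI GK); rewrite mulr0 -[RHS]c_rel mulr_sumr; apply: eq_bigr => i _.
by rewrite mulrA -intrM [G%:Z * _]mulrC divzK.
Qed.

End IntegerRelations.

Lemma principal_ideal (R : comNzRingType) (d : R) : exists D : ideal R,
  forall a, a \in ideal_mem D <-> exists r, a = d * r.
Proof.
have [||| D DE] := @ideal_of_set R [set a | exists r, a = d * r].
- by exists 0; rewrite mulr0.
- by move=> _ _ [r ->] [s ->]; exists (r - s); rewrite mulrBr.
- by move=> a _ [r ->]; exists (a * r); rewrite mulrCA.
by exists D => a; split=> [/ideal_memP|ad]; [|apply/ideal_memP]; rewrite DE.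
Qed.

(* [P] is an associated prime of the ring modulo [D]. *)
Lemma exists_annihilated (R : comNzRingType) (D P : ideal R) :
    finite_index D -> prime_ideal P -> {subset ideal_mem D <= ideal_mem P} ->
  exists2 z, z \notin ideal_mem D &
    forall t, t \in ideal_mem P -> z * t \in ideal_mem D.
Proof.
move=> D_fin P_prime DP.
pose ann z := [set a | z * a \in ideal_mem D].
(* A maximal annihilator inside [P] will turn out to contain [P]. *)
pose Phi (B : set R) := exists2 z, B = ann z & B `<=` ideal_set P.
have sat B a c : Phi B -> c - a \in ideal_mem D -> B a -> B c.
  move=> [z -> _] ca /= az; rewrite /ann /= -[c](subrK a) mulrDr.
  by apply: rpredD => //; apply: ideal_mull.
have [|_ [[z -> annP] _ ann_max]] := exists_maximal_set D_fin sat (B0 := ann 1).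
  by exists 1 => // a; rewrite /ann /= mul1r => /DP/ideal_memP.
have zD : z \notin ideal_mem D.
  apply/negP => zD; have /annP/ideal_memP : ann z 1 by rewrite /ann /= mulr1.
  exact/negP/prime_ideal1.
(* For [a] outside [P], [ann (a * z)] is still inside [P] and contains [ann z], so by maximality the
   two are equal. *)
have cancel a c : a \notin ideal_mem P -> ann z (a * c) -> ann z c.
  move=> aP azc; apply: (ann_max (ann (a * z))).
  - exists (a * z) => // e ae; have /annP/ideal_memP : ann z (a * e).
      by rewrite /ann /= mulrA [z * a]mulrC.
    by rewrite prime_idealM // (negPf aP) => /ideal_memP.
  - by move=> e; rewrite /ann /= -mulrA; apply: ideal_mull.
  - by rewrite /ann /= [a * z]mulrC -mulrA.
exists z => // t tP; apply: contrapT => tz.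
have [i [j [ij]]] := finite_index_pigeonhole (GRing.exp t) D_fin.
rewrite -(subnK ij) addnS exprS exprD; move: (j - i.+1)%N => k.
have -> : t ^+ i - t * (t ^+ k * t ^+ i) = (1 - t * t ^+ k) * t ^+ i by ring.
move=> tiD; have {tiD} : ann z (t ^+ i).
  apply: (cancel (1 - t * t ^+ k)); last exact: ideal_mull.
  apply: contraNN (prime_ideal1 P_prime) => tkP.
  by rewrite -[1](subrK (t * t ^+ k)) rpredD // ideal_mulr.
elim: i {ij} => [|i IHi]; first by rewrite /ann /= expr0 mulr1 (negPf zD).
(* If [t ^+ i] does not annihilate [z], then by [cancel] the set [ann (z * t ^+ i)] is inside [P];
   it contains [ann z] and [t], so maximality puts [t] in [ann z]. *)
move=> zti1; apply: IHi; apply: contrapT => zti.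
apply: tz; apply: (ann_max (ann (z * t ^+ i))).
- exists (z * t ^+ i) => // e; rewrite /ann /= -mulrA => ze.
  apply/ideal_memP; apply: contraT => eP; case: zti; apply: (cancel e) => //.
  by rewrite /ann /= [e * _]mulrC.
- by move=> e; rewrite /ann /= mulrAC; apply: ideal_mulr.
- by rewrite /ann /= -mulrA -exprSr.
Qed.

(** [y] is a root of the monic polynomial [X^j - X^i + s], whose coefficients are integral, and
    integrality is transitive. *)
Lemma integral_sub_exp (K : fieldExtType rat) (y : K) i j (s : ring_of_integers K) :
  (i < j)%N -> y ^+ i - y ^+ j = val s -> integralOver (intr : int -> K) y.
Proof.
move=> ij ys; pose p : {poly K} := 'X^j + ((val s)%:P - 'X^i).
have p_size : (size ((val s)%:P - 'X^i : {poly K})%R < size ('X^j : {poly K})%R)%N.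
  rewrite size_polyXn ltnS (leq_trans (size_polyD _ _)) // geq_max size_polyN.
  by rewrite size_polyXn ij (leq_trans (size_polyC_leq1 _)) // (leq_trans _ ij).
apply: (@integral_root_monic _ _ _ _ p).
- by rewrite monicE lead_coefDl // lead_coefXn.
- by rewrite rootE !(hornerD, hornerN, hornerC, hornerXn) -ys addrAC subrr sub0r subrr.
apply/integral_poly => k.
suff : p`_k \in integral_over_int (K := K) by move=> /asboolP.
rewrite !coefD coefN coefC !coefXn.
apply: rpredD; first exact: rpred_nat.
apply: rpredB; last exact: rpred_nat.
by case: (k == 0%N); [apply: (valP s)|apply: rpred0].
Qed.

(** * Finite quotients and invertible primes *)

Section RingOfIntegers.
Variable K : fieldExtType rat.
Local Notation A := (ring_of_integers K).
Implicit Types a d : A.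

Lemma int_val_inj : injective (val : A -> K).
Proof. exact: val_inj. Qed.

Lemma int_val_surj (x : K) : integralOver (intr : int -> K) x ->
  exists a : A, val a = x.
Proof. by move=> x_int; exists (RingOfIntegers (asboolT x_int)). Qed.

Lemma ring_of_integers_mulfI d : d != 0 -> injective ( *%R d).
Proof.
move=> d0 a b /(congr1 val); rewrite !rmorphM => /mulfI eqab.
by apply: int_val_inj; apply: eqab; rewrite -(inj_eq int_val_inj) rmorph0 in d0.
Qed.

Definition finite_mod d := exists L : seq A,
  forall a, exists2 l, l \in L & exists r, a - l = d * r.

(** For [p] prime, linear independence over ['F_p] of the classes in [A/pA]. *)
Definition independent_mod (p m : nat) (x : 'I_m -> A) := forall c : 'I_m -> int,
  (exists r, \sum_i (c i)%:~R * x i = p%:R * r) -> forall i, (p %| c i)%Z.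

Lemma independent_mod_leq p m (x : 'I_m -> A) : prime p -> independent_mod p x ->
  (m <= \dim {:K})%N.
Proof.
move=> p_pr x_ind; rewrite leqNgt; apply/negP.
move=> /(primitive_relation (fun i => val (x i)) p_pr)[c [[i ci] c_rel]].
case/negP: ci; apply: x_ind; exists 0; rewrite mulr0; apply: int_val_inj.
rewrite rmorph_sum rmorph0 -[RHS]c_rel; apply: eq_bigr => j _.
by rewrite rmorphM rmorph_int.
Qed.

Lemma finite_mod_prime p : prime p -> finite_mod p%:R.
Proof.
move=> p_pr; have p0 : p%:Z != 0 by rewrite -lt0n prime_gt0.
pose good m := `[< exists x : 'I_m -> A, independent_mod p x >].
have ex_good : exists m, good m.
  by exists 0%N; apply/asboolP; exists (fun=> 0) => c _ [].
have good_le m : good m -> (m <= \dim {:K})%N.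
  by move=> /asboolP[x]; apply: independent_mod_leq.
have [m /asboolP[x x_ind] m_max] := ex_maxnP ex_good good_le.
(* A maximal independent family spans [A/pA]. Coefficients below [p] suffice; the index type
   ['I_p.+1] is visibly inhabited, as [inord] requires. *)
exists [seq \sum_j (f j : nat)%:R * x j | f : {ffun 'I_m -> 'I_p.+1}] => a.
pose y (i : 'I_m.+1) := oapp x a (unlift ord0 i).
have y0 : y ord0 = a by rewrite /y unlift_none.
have yS j : y (lift ord0 j) = x j by rewrite /y liftK.
have [c [[r c_rel] [i ci]]] : exists c : 'I_m.+1 -> int,
    (exists r, \sum_i (c i)%:~R * y i = p%:R * r) /\ exists i, ~~ (p %| c i)%Z.
  apply: contrapT => nc; suff /m_max : good m.+1 by rewrite ltnn.
  apply/asboolP; exists y => c c_rel i; apply: contrapT => ci; case: nc.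
  by exists c; split=> //; exists i; apply/negP.
have {}c_rel : (c ord0)%:~R * a + \sum_j (c (lift ord0 j))%:~R * x j = p%:R * r.
  rewrite -c_rel big_ord_recl y0; congr (_ + _).
  by apply: eq_bigr => j _; rewrite yS.
have c0 : ~~ (p %| c ord0)%Z.
  apply: contra ci => /dvdzP[k ck].
  have c_dvd : forall j, (p %| c (lift ord0 j))%Z.
    apply: x_ind; exists (r - k%:~R * a).
    rewrite mulrBr -c_rel ck intrM -pmulrn; ring.
  by have [j ->|->] := unliftP ord0 i; [apply: c_dvd|rewrite ck dvdz_mull].
have : coprimez p (c ord0).
  by rewrite coprimezE prime_coprime // -dvdzE.
move=> /coprimezP[[v u] /= uv1].
(* Since [u] inverts [c ord0] modulo [p], the relation solved for [a] has these coefficients; they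
   are then reduced modulo [p]. *)
pose e j := (- u * c (lift ord0 j))%Z.
exists (\sum_j (`|(e j %% p)%Z|%N)%:R * x j).
  apply/mapP; exists [ffun j => inord `|(e j %% p)%Z|%N]; first by rewrite mem_enum.
  apply: eq_bigr => j _; rewrite ffunE inordK // ltnS.
  by rewrite -lez_nat gez0_abs ?modz_ge0 // ltW // ltz_mod.
exists (u%:~R * r + v%:~R * a + \sum_j (e j %/ p)%Z%:~R * x j).
have -> : \sum_j (`|(e j %% p)%Z|%N)%:R * x j =
    \sum_j (e j)%:~R * x j - p%:R * \sum_j (e j %/ p)%Z%:~R * x j.
  rewrite mulr_sumr -sumrB; apply: eq_bigr => j _.
  have eE : (e j)%:~R = (e j %/ p)%Z%:~R * p%:R + (e j %% p)%Z%:~R :> A.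
    by rewrite {1}(divz_eq (e j) p) intrD intrM -pmulrn.
  by rewrite pmulrn gez0_abs ?modz_ge0 // eE; ring.
have -> : \sum_j (e j)%:~R * x j = - u%:~R * \sum_j (c (lift ord0 j))%:~R * x j.
  by rewrite mulr_sumr; apply: eq_bigr => j _; rewrite /e intrM mulrNz mulrA.
have -> : \sum_j (c (lift ord0 j))%:~R * x j = p%:R * r - (c ord0)%:~R * a.
  by rewrite -c_rel addrC addKr.
have uv1A : v%:~R * p%:R + u%:~R * (c ord0)%:~R = 1 :> A.
  by rewrite pmulrn -!intrM -intrD uv1.
by rewrite -{1}[a]mul1r -{1}uv1A; ring.
Qed.

Lemma finite_mod_mul d e : finite_mod d -> finite_mod e -> finite_mod (d * e).
Proof.
move=> [L HL] [M HM]; exists [seq l + d * k | l <- L, k <- M] => a.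
have [l lL [r lr]] := HL a; have [k kM [s ks]] := HM r.
exists (l + d * k); first exact: allpairs_f.
by exists s; rewrite opprD addrA lr -mulrBr ks mulrA.
Qed.

Lemma finite_mod_nat n : (0 < n)%N -> finite_mod n%:R.
Proof.
elim/ltn_ind: n => n IHn n0.
have [n1|n1] := leqP n 1.
  have -> : n = 1%N by apply/eqP; rewrite eqn_leq n1.
  by exists [:: 0] => a; exists 0; rewrite ?inE //; exists a; rewrite subr0 mul1r.
have p_pr := pdiv_prime n1.
rewrite -(divnK (pdiv_dvd n)) natrM; apply: finite_mod_mul.
  apply: IHn; first by rewrite ltn_Pdiv ?prime_gt1.
  by rewrite divn_gt0 ?prime_gt0 // dvdn_leq // pdiv_dvd.
exact: finite_mod_prime.
Qed.

(** The constant term of an integer equation for [a] is a multiple of [a]; if it vanishes, a factor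
    ['X] is cancelled. *)
Lemma dvd_nat a : a != 0 -> exists2 n, (0 < n)%N & exists b, n%:R = a * b.
Proof.
move=> a0; have [p p_mon pa] : integralOver (intr : int -> K) (val a).
  by apply/asboolP; case: a {a0}.
have {pa} : int_eval a p = 0.
  apply: int_val_inj; rewrite rmorph0 -(rootP pa) /int_eval -horner_map.
  congr (_.[_]); rewrite -map_poly_comp; apply: eq_map_poly => c.
  exact: (rmorph_int (val : A -> K)).
have : p != 0 by apply: monic_neq0.
elim/poly_ind: p {p_mon} => [|p c IHp]; first by rewrite eqxx.
rewrite rmorphD rmorphM /= int_evalX int_evalC.
have [->|c0] := eqVneq c 0.
  rewrite !addr0 => pX; rewrite mulrC -(mulr0 a) => /(ring_of_integers_mulfI a0).
  by apply: IHp; apply: contraNneq pX => ->; rewrite mul0r.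
move=> _ /eqP; rewrite addr_eq0 => /eqP pac; exists `|c|%N; first by rewrite absz_gt0.
case: (intP c) {c0} pac => [|k|k] pac.
- by exists 0; rewrite mulr0.
- by exists (- int_eval a p); rewrite mulrN mulrC pac opprK absz_nat.
- by exists (int_eval a p); rewrite mulrC pac rmorphN opprK abszN absz_nat.
Qed.

Lemma ring_of_integers_finite_index (I : ideal A) a :
  a \in ideal_mem I -> a != 0 -> finite_index I.
Proof.
move=> aI /dvd_nat[n /finite_mod_nat[L HL] [b nab]]; exists L => c.
have [l lL [r rE]] := HL c; exists l => //.
by rewrite rE nab -mulrA ideal_mulr.
Qed.

Lemma prime_ideal_invertible d (P : ideal A) :
  prime_ideal P -> d \in ideal_mem P -> d != 0 -> invertible P.
Proof.
move=> P_prime dP d0.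
have P_fin := ring_of_integers_finite_index dP d0.
have [D DE] := principal_ideal d.
have D_fin : finite_index D.
  by apply: (@ring_of_integers_finite_index _ d) => //; apply/DE; exists 1; rewrite mulr1.
have DP : {subset ideal_mem D <= ideal_mem P}.
  by move=> _ /DE[r ->]; apply: ideal_mulr.
have [z zD zP] := exists_annihilated D_fin P_prime DP.
(* On [P], [phi] is multiplication by [z / d]; its values elsewhere do not enter [is_dual]. *)
have wit (t : A) : exists s, t \in ideal_mem P -> d * s = z * t.
  have [/zP/DE[s ->]|] := boolP (t \in ideal_mem P); by [exists s|exists 0].
have [phi phiE] := choice wit; have dI := ring_of_integers_mulfI d0.
have phiD t u : t \in ideal_mem P -> u \in ideal_mem P -> phi (t + u) = phi t + phi u.
  by move=> tP uP; apply: dI; rewrite mulrDr !phiE ?rpredD // mulrDr.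
have phiM r t : t \in ideal_mem P -> phi (r * t) = r * phi t.
  by move=> tP; apply: dI; rewrite [RHS]mulrCA !phiE ?ideal_mull // mulrCA.
exists phi; split=> //.
have [t tP phit] : exists2 t, t \in ideal_mem P & phi t \notin ideal_mem P.
  apply: contrapT => nt.
  have phiP t : t \in ideal_mem P -> phi t \in ideal_mem P.
    by move=> tP; apply: contraT => phit; case: nt; exists t.
  pose y : K := val z / val d.
  have vd0 : val d != 0 :> K by rewrite -(inj_eq int_val_inj) rmorph0 in d0.
  have uP n : iter n phi d \in ideal_mem P by elim: n => //= n /phiP.
  (* The iterates of [phi] at [d] stay in [P], so every [d y^n] is in [A]. Two of them agree modulo
     [d], which makes [y] integral and puts [z = d y] in the ideal of [d]. *)
  have uE n : val (iter n phi d) = val d * y ^+ n.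
    elim: n => [|n IHn]; first by rewrite expr0 mulr1.
    have dphi : val d * val (phi (iter n phi d)) = val z * val (iter n phi d) :> K.
      by have := congr1 val (phiE _ (uP n)); rewrite !rmorphM.
    by apply: (mulfI vd0); rewrite iterS dphi IHn exprS /y; field.
  have [i [j [ij /DE[s sE]]]] := finite_index_pigeonhole (fun n => iter n phi d) D_fin.
  have : y ^+ i - y ^+ j = val s.
    by apply: (mulfI vd0); rewrite mulrBr -!uE -rmorphM -rmorphB sE.
  move=> /(integral_sub_exp ij)/int_val_surj[w wy].
  case/negP: zD; apply/DE; exists w; apply: int_val_inj.
  have -> : val (d * w) = val d * val w :> K := rmorphM val d w.
  by rewrite wy /y mulrC divfK.
(* Scaling [t] by an inverse of [phi t] modulo [P] gives the element that [is_dual] asks for. *)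
have [r rt] := prime_ideal_max P_prime P_fin phit.
by exists (r * t); [apply: ideal_mull|rewrite phiM].
Qed.

End RingOfIntegers.

Theorem theorem6 (K : fieldExtType rat) (I : ideal (ring_of_integers K))
    (I_neq0 : ideal_set I <> [set 0]) :
  coverable (quotient I) <-> faulty I.
Proof.
have [a aI a0] : exists2 a, a \in ideal_mem I & a != 0.
  apply: contrapT => na; apply: I_neq0; apply/seteqP; split=> [a /ideal_memP aI|_ ->].
    by apply/eqP; apply: contraT => a0; case: na; exists a.
  exact/ideal_memP/rpred0.
apply: coverable_iff_faulty => [|P P_prime IP].
  exact: ring_of_integers_finite_index aI a0.
exact: prime_ideal_invertible P_prime (IP a aI) a0.
Qed.
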